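(* Let $k \geq 2$ and $\Delta \geq 2$ be constants (integers) satisfying $$\Delta\le \frac{1}{\sqrt{8\mathrm{e}}\,k^2}\cdot2^{k/2}.$$ Then there is a fully polynomial-time approximation scheme (FPTAS) for the number of (weak) independent sets in $k$-uniform hypergraphs with maximum degree $\Delta$.
   Context: A hypergraph $H=(V,\mathcal E)$ is $k$-uniform if every hyperedge has exactly $k$ vertices; its maximum degree is the maximum over vertices $v$ of the number of hyperedges containing $v$. A set $S\subseteq V$ is a (weak) independent set of $H$ if no hyperedge $e\in\mathcal E$ satisfies $e\subseteq S$. An FPTAS for a counting quantity $Z$ is a deterministic algorithm which, given an instance of size $n$ and $\varepsilon\in(0,1)$, outputs $\hat Z$ with $(1-\varepsilon)Z\le \hat Z\le (1+\varepsilon)Z$ in time polynomial in $n$ and $1/\varepsilon$ (here $k,\Delta$ are treated as constants). *)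

(* Defs.v *)
From mathcomp Require Import all_boot all_order all_algebra.
Import Order.TTheory GRing.Theory Num.Theory.

Set Implicit Arguments.
Unset Strict Implicit.
Unset Printing Implicit Defensive.

(** * Model of computation

    First-order LISP: data are binary trees, and a program is a list of mutually
    recursive unary functions (N. D. Jones's language F, "Computability and
    Complexity from a Programming Perspective", 1997).  There is no primitive
    equality test between trees, so every operation is O(1) on a pointer machine
    with shared cons cells, and running time is polynomially related to Turing
    machine time. *)

Inductive tree : Type :=
| leaf
| node of tree & tree.

Definition hd (x : tree) : tree := if x is node y _ then y else leaf.
Definition tl (x : tree) : tree := if x is node _ z then z else leaf.

Inductive expr : Type :=
| EArg
| ENil
| ECons of expr & expr
| EHd of expr
| ETl of expr
| EIf of expr & expr & expr
| ECall of nat & expr.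

Definition program : Type := seq expr.

(** [eval p x e v t]: with the argument of the current function bound to [x],
    [e] evaluates to [v] in exactly [t] steps (one step per operation executed).
    [ECall f e] runs the [f]-th body of [p]; [EIf] takes its else branch exactly
    on [leaf]. *)
Inductive eval (p : program) : tree -> expr -> tree -> nat -> Prop :=
| eval_arg x : eval p x EArg x 1
| eval_nil x : eval p x ENil leaf 1
| eval_cons x e1 e2 v1 v2 t1 t2 :
    eval p x e1 v1 t1 -> eval p x e2 v2 t2 ->
    eval p x (ECons e1 e2) (node v1 v2) (t1 + t2).+1
| eval_hd x e v t : eval p x e v t -> eval p x (EHd e) (hd v) t.+1
| eval_tl x e v t : eval p x e v t -> eval p x (ETl e) (tl v) t.+1
| eval_if_true x e e1 e2 y z v t t1 :
    eval p x e (node y z) t -> eval p x e1 v t1 ->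
    eval p x (EIf e e1 e2) v (t + t1).+1
| eval_if_false x e e1 e2 v t t2 :
    eval p x e leaf t -> eval p x e2 v t2 ->
    eval p x (EIf e e1 e2) v (t + t2).+1
| eval_call x f e y v t t' :
    eval p x e y t -> eval p y (nth ENil p f) v t' ->
    eval p x (ECall f e) v (t + t').+1.

Definition runs (p : program) (x v : tree) (t : nat) : Prop :=
  eval p x (ECall 0 EArg) v t.

Lemma eval_det (p : program) (x : tree) (e : expr) (v v' : tree) (t t' : nat) :
  eval p x e v t -> eval p x e v' t' -> v = v' /\ t = t'.
Proof.
move=> h; elim: h v' t' => {x e v t}; intros;
  match goal with H : eval p _ _ ?w ?s |- _ = ?w /\ _ = ?s =>
    inversion H; clear H; subst
  end;
  repeat match goal with
  | IH : forall v' t', eval p ?x ?e v' t' -> _, H : eval p ?x ?e _ _ |- _ =>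
    case: (IH _ _ H) => ? ?; clear H; subst
  end;
  split; congruence.
Qed.

(** * Encodings *)

Definition enc_bool (b : bool) : tree := if b then node leaf leaf else leaf.

Definition enc_seq (T : Type) (enc : T -> tree) (s : seq T) : tree :=
  foldr (fun y t => node (enc y) t) leaf s.

(** The [l] low-order binary digits of [m], least significant first. *)
Definition bits (l m : nat) : seq bool := [seq odd (m %/ 2 ^ i) | i <- iota 0 l].

Definition bit_length (m : nat) : nat := up_log 2 m.+1.

Definition enc_nat (m : nat) : tree := enc_seq enc_bool (bits (bit_length m) m).

(** The fraction a/b (for 0 < a < b) in binary: the digits of a and b aligned,
    most significant first.  In this order the first O(log (b/a)) entries
    determine a/b up to a constant factor, so a running time bounded in terms of
    b/a alone, whatever the length of a and b, is not ruled out merely by the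
    cost of reading them. *)
Definition enc_frac (a b : nat) : tree :=
  let l := bit_length b in
  enc_seq (fun d => node (enc_bool d.1) (enc_bool d.2))
          (rev (zip (bits l a) (bits l b))).

(** * Fully polynomial-time approximation schemes *)

Section FPTAS.
Local Open Scope ring_scope.

(** [I] is the type of instances, [dom] the instances considered, [enc i x] says
    that the tree [x] is an encoding of [i] (an instance may have several: the
    algorithm must work on all of them), [Z] is the quantity to approximate.
    The accuracy a/b ranges over all rationals in (0,1) and the output is the
    rational num/den.  As size >= 0 and 1/eps > 1, the bounds
    C (size + 1/eps)^c are cofinal among the polynomials in size and 1/eps. *)
Definition is_fptas (I : Type) (dom : I -> Prop) (size : I -> nat)
    (enc : I -> tree -> Prop) (Z : I -> nat) (p : program) : Prop :=
  exists C c : nat,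
  forall (i : I) (x : tree), dom i -> enc i x ->
  forall a b : nat, (0 < a < b)%N ->
  let eps : rat := a%:R / b%:R in
  exists (v : tree) (t num den : nat),
    [/\ runs p (node x (enc_frac a b)) v t,
        t%:R <= C%:R * ((size i)%:R + eps^-1) ^+ c,
        v = node (enc_nat num) (enc_nat den),
        (0 < den)%N
      & (1 - eps) * (Z i)%:R <= num%:R / den%:R <= (1 + eps) * (Z i)%:R].

Definition has_fptas (I : Type) (dom : I -> Prop) (size : I -> nat)
    (enc : I -> tree -> Prop) (Z : I -> nat) : Prop :=
  exists p : program, is_fptas dom size enc Z p.

End FPTAS.

(** * Hypergraphs *)

Record hypergraph : Type := Hypergraph {
  num_vertices : nat;
  hyperedges : {set {set 'I_num_vertices}}
}.

Definition k_uniform (k : nat) (H : hypergraph) : Prop :=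
  forall e, e \in hyperedges H -> #|e| = k.

Definition degree (H : hypergraph) (v : 'I_(num_vertices H)) : nat :=
  #|[set e in hyperedges H | v \in e]|.

Definition max_degree (H : hypergraph) : nat :=
  \max_(v < num_vertices H) degree v.

Definition weak_independent (H : hypergraph) (S : {set 'I_(num_vertices H)}) : bool :=
  [forall e in hyperedges H, ~~ (e \subset S)].

Definition num_independent (H : hypergraph) : nat :=
  #|[set S : {set 'I_(num_vertices H)} | weak_independent S]|.

(** The list of the vertices together with the list of the hyperedges, each
    hyperedge being a list of vertices; hyperedges, and vertices within a
    hyperedge, may come in any order, without repetition. *)
Definition hypergraph_encoding (H : hypergraph) (x : tree) : Prop :=
  exists s : seq (seq 'I_(num_vertices H)),
    [/\ all uniq s,
        perm_eq [seq [set v in e] | e <- s] (enum (hyperedges H))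
      & x = node (enc_seq enc_nat (iota 0 (num_vertices H)))
                 (enc_seq (enc_seq (fun v : 'I_(num_vertices H) => enc_nat v)) s)].

(* Main.v *)
Require Import Defs.
From mathcomp Require Import all_boot all_order all_algebra.
From mathcomp Require Import reals sequences exp.
From mathcomp Require Import zify ring lra.
Set Implicit Arguments.
Unset Strict Implicit.
Unset Printing Implicit Defensive.
Import Order.TTheory GRing.Theory Num.Theory.

(** By self-reducibility the number of independent sets is the product of the inverses of
    the probabilities [q_v] that a vertex [v] is absent from a uniform independent set, the
    edges meeting the vertices already treated being removed at each stage.

    To estimate [q_v], run the systematic-scan heat-bath chain, which is stationary, and
    determine the last value of [v] backwards in time ("coupling towards the past"): an
    update with bit [0] always yields [0], and an update with bit [1] yields [0] exactly when
    some edge has all its other vertices equal to [1].  Only edges all of whose most recent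
    update bits are [1] need a recursive evaluation.  A decision tree reveals the bits on
    demand, up to [B = O(log (n / eps))] of them, and counts the leaves with value [0].

    The tree exceeds its budget only if there is a large connected set of space-time edges
    (windows of [k] updates) whose bits are all [1]; it contains many pairwise disjoint
    windows, each within two steps of an earlier one.  A window meets at most [k ^ 2 Delta]
    windows, so when [16 (k ^ 2 Delta) ^ 2 <= 2 ^ k] the union bound over such families of
    [m] windows decays like [4 ^- m]. *)

(** * The estimator *)

(** No mixing estimate is involved. The initial state is summed over all independent sets together
    with the random bits, so the law stays exactly uniform, and the number of sweeps only has to
    exceed what a tree with [B] revealed bits can look at. Errors are one-sided: unresolved branches
    count for nothing, so the estimate of [q_v] is never too large. As [q_v >= 1/2], an additive
    loss becomes a relative loss at most twice as large.

    The windows of the family are disjoint so that their bits are independent. Instead of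
    enumerating families, each waiting candidate gets a weight [beta = 1 + 1/d] with
    [d = (k ^ 2 * Delta) ^ 2]: since [beta ^ d <= 4] and each further window is to gain a factor
    [4], the requirement is [16 * d <= 2 ^ k], which follows from the hypothesis because
    [8 e >= 16].

    The branching of the tree and of the recursion is bounded in terms of [k] and [Delta], while
    their depth is [O(log (n / eps))]; this makes the running time polynomial. *)

(* [(u, s)] is the update of vertex [u] in the [s]-th sweep counted from the end, and
   [posn p w] is the last update of [w] that does not come after [p]. *)
Definition pos : Type := (nat * nat)%type.

Definition posn (p : pos) (w : nat) : pos := (w, if w <= p.1 then p.2 else p.2.+1).

Definition window (e : seq nat) (p : pos) : seq pos := [seq posn p w | w <- e].

(* [Need p]: the bit at [p] has to be revealed first. *)
Inductive res : Type := Val of bool | Need of pos.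

Definition neg (x : res) : res := if x is Val b then Val (~~ b) else x.

Definition seqand (x y : res) : res := if x is Val true then y else x.

Fixpoint seqall (T : Type) (f : T -> res) (s : seq T) : res :=
  if s is x :: s' then seqand (f x) (seqall f s') else Val true.

Fixpoint look (tb : seq (pos * bool)) (p : pos) : res :=
  if tb is (q, b) :: tb' then if p == q then Val b else look tb' p else Need p.

Definition scan tb p e : res := seqall (fun w => look tb (posn p w)) e.

(* Scanning all bits of the window first ensures that recursive calls only occur through
   windows of ones, which is what the tail bound needs.  The value [Val true] for exhausted
   fuel is junk: [ev_val] excludes this case. *)
Fixpoint ev (fuel : nat) (E : seq (seq nat)) (tb : seq (pos * bool)) (p : pos) : res :=
  seqand (look tb p)
    (if fuel is f.+1 then
       seqall (fun e => if p.1 \in e then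
         neg (seqand (scan tb p e)
           (seqall (fun w => if w == p.1 then Val true else ev f E tb (posn p w)) e))
         else Val true) E
     else Val true).

(* Branches that still need a bit when the budget [b] is exhausted count for nothing. *)
Fixpoint cnt (fuel : nat) (E : seq (seq nat)) (v b : nat) (tb : seq (pos * bool)) : nat :=
  match ev fuel E tb (v, 0) with
  | Val false => 2 ^ b
  | Val true => 0
  | Need p => if b is b'.+1 then
      cnt fuel E v b' ((p, false) :: tb) + cnt fuel E v b' ((p, true) :: tb) else 0
  end.

(** [den] collects the product of the counts, so the estimate is [2 ^ (B * n) / den]. Dropping the
    edges at [v] amounts to conditioning on the absence of [v]. *)
Fixpoint stage (B : nat) (vs : seq nat) (E : seq (seq nat)) (den : nat) : nat :=
  if vs is v :: vs' then
    stage B vs' [seq e <- E | v \notin e] (den * cnt B.+1 E v B [::])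
  else den.

(** * Boolean cubes *)

Notation cube N := {ffun 'I_N -> bool}.

Definition cb N (x : cube N) (i : nat) : bool := if insub i is Some j then x j else false.

Definition setb N (x : cube N) (i : nat) (b : bool) : cube N :=
  [ffun j : 'I_N => if val j == i then b else x j].

Lemma cb_out N (x : cube N) i : N <= i -> cb x i = false.
Proof. by move=> h; rewrite /cb insubF // ltnNge h. Qed.

Lemma cb_ord N (x : cube N) (j : 'I_N) : cb x j = x j.
Proof. by rewrite /cb valK. Qed.

Lemma cb_setb N (x : cube N) i b j :
  cb (setb x i b) j = if (j == i) && (i < N) then b else cb x j.
Proof.
have [jN|Nj] := ltnP j N; last first.
  rewrite !cb_out //; case: eqP => //= <-.
  by rewrite ltnNge Nj.
have -> : j = val (Ordinal jN) by [].
rewrite !cb_ord ffunE /=; case: (eqVneq j i) => //= <-.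
by rewrite jN.
Qed.

Lemma cubeP N (x y : cube N) : cb x =1 cb y -> x = y.
Proof. by move=> h; apply/ffunP=> j; rewrite -!cb_ord h. Qed.

Lemma setb_setb N (x : cube N) i b c : setb (setb x i b) i c = setb x i c.
Proof. by apply: cubeP => j; rewrite !cb_setb; case: (_ && _). Qed.

Lemma setb_id N (x : cube N) i : setb x i (cb x i) = x.
Proof. by apply: cubeP => j; rewrite cb_setb; case: ifP => // /andP[/eqP->]. Qed.

Section Mean.
Local Open Scope ring_scope.

Lemma sum_setb N (i : nat) (h : cube N -> rat) :
  \sum_x (h (setb x i false) + h (setb x i true)) = 2 * \sum_x h x.
Proof.
pose flip (x : cube N) := setb x i (~~ cb x i).
have flipK : involutive flip.
  move=> x; rewrite /flip setb_setb cb_setb eqxx /=.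
  have [iN|Ni] := ltnP i N; first by rewrite negbK setb_id.
  by apply: cubeP => j; rewrite cb_setb ltnNge Ni andbF.
have -> : 2 * \sum_x h x = \sum_x h x + \sum_x h (flip x).
  by rewrite (reindex_inj (inv_inj flipK)) mulr2n mulrDl mul1r [in RHS]addrC;
     congr (_ + _); rewrite [RHS](reindex_inj (inv_inj flipK)); apply: eq_bigr => x _;
     rewrite flipK.
rewrite -big_split /=; apply: eq_bigr => x _.
rewrite /flip -[X in _ = h X + _](setb_id x i); case: (cb x i) => /=; last by [].
by rewrite addrC.
Qed.

Definition mean N (f : cube N -> rat) : rat := (\sum_x f x) / 2 ^+ N.

Lemma mean_setb N (i : nat) (f : cube N -> rat) :
  mean f = (mean (fun x => f (setb x i false)) + mean (fun x => f (setb x i true))) / 2.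
Proof.
rewrite /mean -mulrDl -big_split /= sum_setb.
by field; rewrite expf_neq0.
Qed.

Lemma eq_mean N (f g : cube N -> rat) : f =1 g -> mean f = mean g.
Proof. by move=> h; congr (_ / _); apply: eq_bigr. Qed.

Lemma le_mean N (f g : cube N -> rat) : (forall x, f x <= g x) -> mean f <= mean g.
Proof.
move=> h; rewrite /mean ler_pM2r ?invr_gt0 ?exprn_gt0 //.
by apply: ler_sum => x _.
Qed.

Lemma meanD N (f g : cube N -> rat) : mean (fun x => f x + g x) = mean f + mean g.
Proof. by rewrite /mean big_split mulrDl. Qed.

Lemma meanZ N (c : rat) (f : cube N -> rat) : mean (fun x => c * f x) = c * mean f.
Proof. by rewrite /mean -mulr_sumr mulrA. Qed.

Lemma mean_cst N (c : rat) : mean (fun _ : cube N => c) = c.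
Proof.
rewrite /mean sumr_const card_ffun card_bool card_ord -[c *+ _]mulr_natr natrX mulfK //.
by rewrite expf_neq0.
Qed.

End Mean.

(** * Independent sets and the heat-bath update *)

Section Update.
Variables (n : nat) (E : seq (seq nat)).
Implicit Types (S : cube n) (u : nat).

Definition indep S : bool := all (fun e => ~~ all (cb S) e) E.

Definition free S u : bool :=
  all (fun e => (u \in e) ==> ~~ all (fun w => (w == u) || cb S w) e) E.

Definition update S u b : cube n := setb S u (b && free S u).

Lemma free_setb S u b : free (setb S u b) u = free S u.
Proof.
apply: eq_all => e; congr (_ ==> ~~ _); apply: eq_all => w.
by rewrite cb_setb; case: eqP.
Qed.

Lemma update_setb S u b c : update (setb S u b) u c = setb S u (c && free S u).
Proof. by rewrite /update setb_setb free_setb. Qed.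

Lemma indep_setb S u : u < n ->
  indep (setb S u true) = indep (setb S u false) && free S u.
Proof.
move=> un; rewrite /indep /free; elim: E => //= e E' ->.
suff -> : ~~ all (cb (setb S u true)) e = ~~ all (cb (setb S u false)) e &&
    ((u \in e) ==> ~~ all (fun w => (w == u) || cb S w) e).
  by rewrite -!andbA; congr (_ && _); rewrite andbCA.
have [ue|ue] := boolP (u \in e).
  have -> : all (cb (setb S u false)) e = false.
    by apply/negbTE/allPn; exists u; rewrite // cb_setb eqxx un.
  rewrite /=; congr (~~ _); apply: eq_all => w; rewrite cb_setb un andbT.
  by case: eqP.
rewrite andbT; congr (~~ _); apply: eq_in_all => w we; rewrite !cb_setb un andbT.
by case: eqP => // wu; rewrite -wu we in ue.
Qed.

Local Open Scope ring_scope.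

Definition isum (f : cube n -> rat) : rat := \sum_S (indep S)%:R * f S.

(** Stationarity of the uniform measure: given the other coordinates, the update draws the value at
    [u] uniformly from the admissible ones, whatever the present value is. *)
Lemma isum_update u (f : cube n -> rat) : (u < n)%N ->
  isum (fun S => f (update S u false) + f (update S u true)) = 2 * isum f.
Proof.
(* After doubling, both sides can be summed over the two values at [u], and the identity holds for
   each setting of the other coordinates. *)
move=> un; apply: (@mulfI _ (2 : rat)) => //.
rewrite /isum -(sum_setb u) /= -[X in _ = 2 * (2 * X)]mul1r.
rewrite [X in 2 * (2 * X)]mul1r -(sum_setb u) mulr_sumr.
apply: eq_bigr => S _; rewrite !update_setb (indep_setb _ un) /=.
case: (indep _); case: (free _ _); rewrite /= ?mul0r ?mul1r; ring.
Qed.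

Lemma eq_isum (f g : cube n -> rat) : f =1 g -> isum f = isum g.
Proof. by move=> h; apply: eq_bigr => S _; rewrite h. Qed.

Lemma le_isum (f g : cube n -> rat) : (forall S, f S <= g S) -> isum f <= isum g.
Proof. by move=> h; apply: ler_sum => S _; rewrite ler_wpM2l. Qed.

Lemma isumD (f g : cube n -> rat) : isum (fun S => f S + g S) = isum f + isum g.
Proof. by rewrite /isum -big_split; apply: eq_bigr => S _; rewrite mulrDr. Qed.

Lemma isumZ c (f : cube n -> rat) : isum (fun S => c * f S) = c * isum f.
Proof. by rewrite /isum mulr_sumr; apply: eq_bigr => S _; rewrite mulrCA. Qed.

End Update.

(** * Systematic scan *)

Section Scan.
Variables (n T : nat) (E : seq (seq nat)).

Fixpoint sweep (g : pos -> bool) (s : nat) (S : cube n) (u : nat) : cube n :=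
  if u is u'.+1 then update E (sweep g s S u') u' (g (u', s)) else S.

(* Rounds are numbered backwards: round [0] is the last one, round [T.-1] the first. *)
Fixpoint sweeps (g : pos -> bool) (S : cube n) (d : nat) : cube n :=
  if d is d'.+1 then sweep g (T.-1 - d') (sweeps g S d') n else S.

(** The value of [p.1] right after its update at [p]; by then the sweeps from [T.-1] down to
    [p.2.+1] are complete. *)
Definition value (g : pos -> bool) (S : cube n) (p : pos) : bool :=
  cb (sweep g p.2 (sweeps g S (T.-1 - p.2)) p.1.+1) p.1.

Lemma cb_sweep_lt g s S u w : w < u -> cb (sweep g s S u) w = cb (sweep g s S w.+1) w.
Proof.
elim: u => // u IH; rewrite ltnS leq_eqVlt => /predU1P[->//|wu].
by rewrite /= /update cb_setb ltn_eqF //= IH.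
Qed.

Lemma cb_sweep_ge g s S u w : u <= w -> cb (sweep g s S u) w = cb S w.
Proof.
elim: u => // u IH uw; rewrite /= /update cb_setb gtn_eqF //= IH //; exact: ltnW.
Qed.

(** No update of [w] takes place between [posn p w] and [p], so the value is still current. The
    bound on [p.2] keeps the window away from the initial state. *)
Lemma value_rec g S p : p.1 < n -> p.2.+1 < T -> (forall e, e \in E -> all (gtn n) e) ->
  value g S p = g p &&
    all (fun e => (p.1 \in e) ==> ~~ all (fun w => (w == p.1) || value g S (posn p w)) e) E.
Proof.
case: p => u s /= un sT hE.
rewrite {1}/value /= /update cb_setb eqxx un /=; congr (_ && _).
apply: eq_in_all => e /hE/allP en; congr (_ ==> ~~ _).
apply: eq_in_all => w /en /= wn; case: eqVneq => //= wu.
rewrite /value /posn /=; case: leqP => [wu'|uw].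
  by rewrite cb_sweep_lt // ltn_neqAle wu.
rewrite cb_sweep_ge ?(ltnW uw) //.
have -> : T.-1 - s = (T.-1 - s.+1).+1 by lia.
rewrite [sweeps _ _ _.+1]/=; have -> : T.-1 - (T.-1 - s.+1) = s.+1 by lia.
by rewrite (@cb_sweep_lt _ _ _ n).
Qed.

Lemma eq_sweep g g' s S u : (forall w, w < u -> g (w, s) = g' (w, s)) ->
  sweep g s S u = sweep g' s S u.
Proof.
elim: u => //= u IH h; rewrite h // IH // => w wu; apply: h; exact: ltnW.
Qed.

Lemma eq_sweeps g g' S d : d <= T ->
  (forall w s, w < n -> T - d <= s < T -> g (w, s) = g' (w, s)) ->
  sweeps g S d = sweeps g' S d.
Proof.
elim: d => //= d IH dT h; rewrite IH; last 2 first.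
- exact: ltnW.
- by move=> w s wn hs; apply: h => //; lia.
by apply: eq_sweep => w wn; apply: h => //; lia.
Qed.

Definition rb (r : cube (n * T)) (p : pos) : bool := (p.1 < n) && cb r (p.2 * n + p.1).

Definition setp (r : cube (n * T)) (p : pos) b : cube (n * T) := setb r (p.2 * n + p.1) b.

Lemma rb_setp r p b q : p.1 < n -> p.2 < T ->
  rb (setp r p b) q = if q == p then b else rb r q.
Proof.
case: p q => u s [w s'] /= un sT; rewrite /rb /setp /= cb_setb.
have -> : s * n + u < n * T by nia.
rewrite andbT xpair_eqE; have [wn|] := ltnP w n; last first.
  by move=> nw; have -> : (w == u) = false by lia.
rewrite /=; suff -> : (s' * n + w == s * n + u) = (w == u) && (s' == s) by [].
apply/eqP/andP => [h|[/eqP-> /eqP->] //].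
have ss : s' = s.
  have := congr1 (divn^~ n) h; rewrite !divnMDl ?(divn_small wn) ?(divn_small un); lia.
by rewrite ss; split => //; apply/eqP; rewrite ss in h; lia.
Qed.

Lemma rb_out r p : T <= p.2 -> rb r p = false.
Proof. by move=> h; rewrite /rb cb_out ?andbF //; nia. Qed.

Local Open Scope ring_scope.

(** The bit used by the latest update is fresh: the state before it does not depend on that bit, so
    averaging over it alone is [isum_update]. *)
Lemma mean_sweep d u (f : cube n -> rat) : (d < T)%N -> (u <= n)%N ->
  (forall f', mean (fun r => isum E (fun S => f' (sweeps (rb r) S d))) = isum E f') ->
  mean (fun r => isum E (fun S => f (sweep (rb r) (T.-1 - d) (sweeps (rb r) S d) u)))
  = isum E f.
Proof.
move=> dT + IHd; elim: u f => [|u IH] f un; first exact: IHd.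
pose p : pos := (u, (T.-1 - d)%N).
have p2 : (p.2 < T)%N by rewrite /p /=; lia.
pose F S r := sweep (rb r) (T.-1 - d) (sweeps (rb r) S d) u.
have FE S r b : F S (setp r p b) = F S r.
  rewrite /F (@eq_sweeps _ (rb r)) ?(ltnW dT) //; last first.
    move=> w s wn hs; rewrite rb_setp // /p xpair_eqE.
    by rewrite [s == _]gtn_eqF ?andbF //; lia.
  by apply: eq_sweep => w wu; rewrite rb_setp // /p xpair_eqE ltn_eqF.
rewrite (mean_setb (p.2 * n + p.1)) -meanD.
under eq_mean => r.
  rewrite -isumD; under eq_isum => S.
    rewrite /= -/(setp r p false) -/(setp r p true) -/(F S (setp r p false)).
    rewrite -/(F S (setp r p true)) !FE -/p !rb_setp // !eqxx.
    over.
  over.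
rewrite /= /F (IH (fun X => f (update E X u false) + f (update E X u true))); last exact: ltnW.
by rewrite isum_update //; field.
Qed.

Lemma mean_sweeps d (f : cube n -> rat) : (d <= T)%N ->
  mean (fun r => isum E (fun S => f (sweeps (rb r) S d))) = isum E f.
Proof.
elim: d f => [|d IH] f dT /=; first by rewrite mean_cst.
by apply: mean_sweep => // f'; apply: IH; exact: ltnW.
Qed.

Lemma mean_value v (f : bool -> rat) : (v < n)%N -> (0 < T)%N ->
  mean (fun r => isum E (fun S => f (value (rb r) S (v, 0%N)))) =
  isum E (fun S : cube n => f (cb S v)).
Proof.
move=> vn T0.
have := @mean_sweep T.-1 v.+1 (fun S => f (cb S v)).
rewrite subnn /value /= subn0 => -> //; first by rewrite prednK.
by move=> f'; apply: mean_sweeps; exact: leq_pred.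
Qed.

End Scan.

(** * Evaluation against a table of revealed bits *)

Lemma seqall_true (T : eqType) (f : T -> res) s :
  seqall f s = Val true -> forall x, x \in s -> f x = Val true.
Proof.
elim: s => //= y s IH; case hy: (f y) => [[]|] //= /IH h x.
by rewrite in_cons => /predU1P[->//|/h].
Qed.

Lemma seqall_false (T : eqType) (f : T -> res) s :
  seqall f s = Val false -> exists2 x, x \in s & f x = Val false.
Proof.
elim: s => //= y s IH; case hy: (f y) => [[]|] //=.
  by case/IH=> x xs hx; exists x; rewrite // in_cons xs orbT.
by move=> _; exists y; rewrite ?mem_head.
Qed.

Lemma seqall_need (T : eqType) (f : T -> res) s p :
  seqall f s = Need p -> exists2 x, x \in s & f x = Need p.
Proof.
elim: s => //= y s IH; case hy: (f y) => [[]|q] //=.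
  by case/IH=> x xs hx; exists x; rewrite // in_cons xs orbT.
by move=> [<-]; exists y; rewrite ?mem_head.
Qed.

Definition keys (tb : seq (pos * bool)) : seq pos := [seq x.1 | x <- tb].

Definition agree (tb : seq (pos * bool)) (g : pos -> bool) : bool :=
  all (fun x => g x.1 == x.2) tb.

Lemma look_val tb p b : look tb p = Val b -> p \in keys tb.
Proof.
elim: tb => //= -[q c] tb IH; rewrite in_cons /=; case: eqP => //= _; exact: IH.
Qed.

Lemma look_agree tb p b g : agree tb g -> look tb p = Val b -> g p = b.
Proof.
elim: tb => //= -[q c] tb IH /= /andP[/eqP gq /IH{}IH].
by case: eqP => [-> [<-]|].
Qed.

Lemma look_need tb p q : look tb p = Need q -> q = p /\ p \notin keys tb.
Proof.
elim: tb => [[]|[r c] tb IH] //=; rewrite in_cons; case: eqP => //= _; exact: IH.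
Qed.

(** [q] precedes [p] in time; a larger sweep index lies further in the past. *)
Definition earlier (p q : pos) : bool := (p.2 < q.2) || ((q.2 == p.2) && (q.1 < p.1)).

Lemma earlier_posn p w : w != p.1 -> earlier p (posn p w).
Proof.
case: p => u s; rewrite /earlier /posn /= => wu; case: (leqP w u) => [|_]; last by rewrite ltnSn.
by rewrite leq_eqVlt (negbTE wu) /= eqxx => ->; rewrite orbT.
Qed.

(** The termination measure: recursive calls go to revealed positions further back, so fuel above
    the number of revealed positions never runs out. *)
Lemma count_earlier (s : seq pos) p q : q \in s -> earlier p q ->
  count (earlier q) s < count (earlier p) s.
Proof.
move=> qs pq.
have sub : subpred (earlier q) (earlier p).
  by move=> r; move: pq; rewrite /earlier; lia.
elim: s qs => //= r s IH; rewrite in_cons => /predU1P[<-|/IH{}IH].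
  by rewrite pq /earlier !ltnn andbF /= add0n add1n ltnS sub_count.
have := sub r; case: (earlier q r) => [->//|_]; case: (earlier p r); lia.
Qed.

Section Evaluation.
Variable E : seq (seq nat).

(** The recursion for [V] is required at revealed positions only, because [value_rec] holds only for
    small sweep indices. *)
Lemma ev_val tb g (V : pos -> bool) : agree tb g ->
  (forall q, q \in keys tb -> V q = g q &&
    all (fun e => (q.1 \in e) ==> ~~ all (fun w => (w == q.1) || V (posn q w)) e) E) ->
  forall fuel p b, count (earlier p) (keys tb) < fuel -> ev fuel E tb p = Val b -> V p = b.
Proof.
move=> tbg hV; elim=> // f IH p b hf /=.
case hl: (look tb p) => [[]|] //=; last first.
  by move=> [<-]; rewrite hV ?(look_val hl) // (look_agree tbg hl).
have pk := look_val hl; rewrite hV // (look_agree tbg hl) /=.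
have rec w c : w != p.1 -> look tb (posn p w) = Val true ->
    ev f E tb (posn p w) = Val c -> V (posn p w) = c.
  move=> wp lw; apply: IH; apply: leq_trans (_ : count (earlier p) (keys tb) <= f) => //.
  exact: count_earlier (look_val lw) (earlier_posn wp).
case: b => [/seqall_true hT|/seqall_false[e eE]].
  apply/allP => e eE; apply/implyP => pe; move: (hT e eE); rewrite pe.
  case hs: (scan tb p e) => [[]|] //=.
    case h2: (seqall _ e) => [[]|] //= _; case: (seqall_false h2) => w we.
    case: eqVneq => // wp hw; apply/allPn; exists w; rewrite // (negbTE wp) /=.
    by rewrite (rec _ _ wp (seqall_true hs we) hw).
  move=> _; case: (seqall_false hs) => w we hw; apply/allPn; exists w => //.
  rewrite negb_or; apply/andP; split.
    (* The window contains [p] itself, whose bit is known to be [1]; the zero must sit at another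
       vertex. *)
    by apply/eqP => wp; move: hw; rewrite wp /posn leqnn -surjective_pairing hl.
  by rewrite hV ?(look_val hw) // (look_agree tbg hw).
case: ifP => // pe; case hs: (scan tb p e) => [[]|] //=.
case h2: (seqall _ e) => [[]|] //= _; apply/negbTE/allPn; exists e => //.
rewrite pe negbK; apply/allP => w we; case: eqVneq => //= wp.
have := seqall_true h2 we; rewrite (negbTE wp) => /rec -> //; exact: seqall_true hs _ we.
Qed.

Section Reach.
Variables (g : pos -> bool) (root : pos).

(** An upper bound for the positions of recursive calls in terms of the bits alone, free of table
    and fuel. *)
Inductive reach : pos -> Prop :=
| reach_root : reach root
| reach_step p e w : reach p -> e \in E -> p.1 \in e -> all g (window e p) -> w \in e ->
    reach (posn p w).

(** A requested bit lies in a window anchored at a reached position, but that window need not turn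
    out all ones; the covering below must therefore include all windows around reached positions. *)
Lemma ev_need tb fuel p q : agree tb g -> reach p -> ev fuel E tb p = Need q ->
  q \notin keys tb /\
  (q = p \/ exists p' e, [/\ p' \in keys tb, reach p', e \in E, p'.1 \in e & q \in window e p']).
Proof.
move=> tbg; elim: fuel p => [|f IH] p pR /=; case hl: (look tb p) => [[]|] //=.
  by move=> [<-]; case: (look_need hl) => -> ?; split; [|left].
  move=> /seqall_need[e eE]; case: ifP => // pe.
  case hs: (scan tb p e) => [[]|q'] //=.
    case h2: (seqall _ e) => [[]|q'] //= -[qq]; rewrite qq in h2.
    case: (seqall_need h2) => w we; case: eqVneq => // wp /IH.
    case; first apply: (reach_step pR eE pe _ we).
      apply/allP => _ /mapP[x xe ->].
      exact: look_agree tbg (seqall_true hs xe).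
    move=> qk hq; split=> //; right; case: hq => [->|//].
    by exists p, e; split=> //; [exact: look_val hl|exact: map_f].
  move=> [<-]; case: (seqall_need hs) => w we /look_need[-> wk]; split=> //.
  by right; exists p, e; split=> //; [exact: look_val hl|exact: map_f].
by move=> [<-]; case: (look_need hl) => -> ?; split; [|left].
Qed.

End Reach.
End Evaluation.

(** * The union bound over disjoint windows *)

Record regular (n k Delta : nat) (E : seq (seq nat)) : Prop := Regular {
  regular_uniq : forall e, e \in E -> uniq e;
  regular_size : forall e, e \in E -> size e = k;
  regular_lt : forall e, e \in E -> all (gtn n) e;
  regular_degree : forall u, count (fun e : seq nat => u \in e) E <= Delta }.

Lemma size_flatten_le (T T' : eqType) (f : T -> seq T') s c :
  (forall x, x \in s -> size (f x) <= c) -> size (flatten (map f s)) <= size s * c.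
Proof.
elim: s => //= x s IH h; rewrite size_cat mulSn leq_add ?h ?mem_head // IH //.
by move=> y ys; apply: h; rewrite in_cons ys orbT.
Qed.

Lemma uniq_window e p : uniq e -> uniq (window e p).
Proof. by move=> ue; rewrite map_inj_uniq // => x y []. Qed.

Definition stwindow := (seq nat * pos)%type.

Definition win (h : stwindow) : seq pos := window h.1 h.2.

Section Growth.
Variables (n k Delta : nat) (E : seq (seq nat)).
Hypothesis hE : regular n k Delta E.

Definition edges_at (u : nat) : seq (seq nat) := [seq e <- E | u \in e].

Lemma size_edges_at u : size (edges_at u) <= Delta.
Proof. by rewrite size_filter (regular_degree hE). Qed.

Definition around (q : pos) : seq pos := flatten [seq window e q | e <- edges_at q.1].

Lemma size_around q : size (around q) <= k * Delta.
Proof.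
rewrite mulnC; apply: leq_trans (leq_mul (size_edges_at q.1) (leqnn k)).
apply: size_flatten_le => e; rewrite mem_filter => /andP[_ /(regular_size hE)].
by rewrite size_map => ->.
Qed.

(** Inverse of [posn] in its first argument: [back (posn p w) p.1 = p]. *)
Definition back (q : pos) (u : nat) : pos := (u, if q.1 <= u then q.2 else q.2.-1).

(** A window sharing a position with [h] is determined by that position, an edge through it and the
    anchor in that edge, which gives [k * Delta * k] choices. *)
Definition nbrs (h : stwindow) : seq stwindow :=
  flatten [seq flatten [seq [seq (e, back q u) | u <- e] | e <- edges_at q.1] | q <- win h].

Definition nbrs2 (h : stwindow) : seq stwindow := flatten [seq nbrs f | f <- nbrs h].

Lemma mem_nbrs h f q : f.1 \in E -> f.2.1 \in f.1 -> q \in win h -> q \in win f ->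
  f \in nbrs h.
Proof.
case: f => e [u s] /= eE ue + /mapP[w we qw]; rewrite qw => {qw} qh.
apply/flattenP; eexists; first by apply: map_f; exact: qh.
apply/flattenP; exists [seq (e, back (posn (u, s) w) u') | u' <- e].
  by apply/mapP; exists e; rewrite // mem_filter /= eE andbT.
apply/mapP; exists u => //; rewrite /back /posn /=; congr (_, (_, _)).
by case: leqP.
Qed.

Lemma nbrs_E h f : f \in nbrs h -> f.1 \in E.
Proof.
move=> /flattenP[_ /mapP[q _ ->]] /flattenP[_ /mapP[e + ->]].
by rewrite mem_filter => /andP[_ eE] /mapP[u _ ->].
Qed.

Lemma nbrs2_E h f : f \in nbrs2 h -> f.1 \in E.
Proof. by move=> /flattenP[_ /mapP[f' _ ->]]; exact: nbrs_E. Qed.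

Lemma size_win h : h.1 \in E -> size (win h) = k.
Proof. by rewrite size_map => /(regular_size hE). Qed.

Lemma size_nbrs h : h.1 \in E -> size (nbrs h) <= k ^ 2 * Delta.
Proof.
move=> hh; have -> : k ^ 2 * Delta = k * (Delta * k) by ring.
rewrite -(size_win hh); apply: size_flatten_le => q _.
rewrite (size_win hh); apply: leq_trans (leq_mul (size_edges_at q.1) (leqnn k)).
apply: size_flatten_le => e; rewrite mem_filter => /andP[_ /(regular_size hE)].
by rewrite size_map => ->.
Qed.

Lemma size_nbrs2 h : h.1 \in E -> size (nbrs2 h) <= (k ^ 2 * Delta) ^ 2.
Proof.
move=> hh; apply: leq_trans (leq_mul (size_nbrs hh) (leqnn _)).
by apply: size_flatten_le => f /nbrs_E/size_nbrs.
Qed.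

(* [m] further pairwise disjoint all-ones windows, avoiding [A], can be found by a search
   starting from the candidates [c] and moving in steps of length two. *)
Fixpoint grow (g : pos -> bool) (m : nat) : seq stwindow -> seq pos -> bool :=
  if m is m'.+1 then
    fix grow_from c A :=
      if c is h :: c' then
        grow_from c' A ||
        [&& all g (win h), ~~ has (mem A) (win h) & grow g m' (c' ++ nbrs2 h) (win h ++ A)]
      else false
  else fun _ _ => true.

Lemma growS g m h c A : grow g m.+1 (h :: c) A = grow g m.+1 c A ||
  [&& all g (win h), ~~ has (mem A) (win h) & grow g m (c ++ nbrs2 h) (win h ++ A)].
Proof. by []. Qed.

(** Select a candidate whenever this is possible. The search fails on that branch too, so the greedy
    run exhausts its candidates with at most [m] selected windows, and every all-ones candidate
    meets what was selected. A selected window has to meet itself, hence the nonemptiness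
    condition. *)
Lemma grow_maximal g m c A : (forall h, h \in c -> h.1 \in E) -> ~~ grow g m c A ->
  exists I : seq stwindow, let X := flatten (map win I) ++ A in
  [/\ size I <= m, (forall h, h \in I -> h.1 \in E),
   (forall h, h \in c -> all g (win h) -> win h != [::] -> has (mem X) (win h)) &
   (forall h f, h \in I -> f \in nbrs2 h -> all g (win f) -> win f != [::] ->
     has (mem X) (win f))].
Proof.
elim: m c A => // m IHm; elim=> [|h c IHc] A cE; first by exists [::].
rewrite growS negb_or => /andP[ng1 ng2].
have cE' h' : h' \in c -> h'.1 \in E by move=> hc; apply: cE; rewrite in_cons hc orbT.
have [/andP[oh nh]|ohn] := boolP (all g (win h) && ~~ has (mem A) (win h)).
  rewrite oh nh /= in ng2; case: (IHm _ _ _ ng2).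
    by move=> f; rewrite mem_cat => /orP[/cE'//|/nbrs2_E].
  move=> I [sI EI cI nI]; exists (h :: I) => /=.
  have eqX : (win h ++ flatten (map win I)) ++ A =i flatten (map win I) ++ win h ++ A.
    by move=> x; rewrite !mem_cat; case: (x \in win h); rewrite /= ?orbT.
  split=> //.
  - by move=> f; rewrite in_cons => /predU1P[->|/EI//]; apply: cE; rewrite mem_head.
  - move=> f; rewrite in_cons => /predU1P[->|fc] of_ nf.
      by case: (win h) nf => // q w _; apply/hasP; exists q; exact: mem_head.
    by rewrite (eq_has eqX) cI // mem_cat fc.
  - move=> f f'; rewrite in_cons (eq_has eqX) => /predU1P[->|fI] f'n of' nf'.
      by rewrite cI // mem_cat f'n orbT.
    exact: nI f'n of' nf'.
case: (IHc A cE' ng1) => I [sI EI cI nI]; exists I; split=> // f.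
rewrite in_cons => /predU1P[->|fc] of_ nf; last exact: cI.
move: ohn; rewrite of_ /= negbK => /hasP[q qh qA]; apply/hasP; exists q => //=.
by rewrite mem_cat [q \in A]qA orbT.
Qed.

Definition start (root : pos) : seq stwindow := [seq (e, root) | e <- edges_at root.1].

(** Along a path of all-ones windows each one meets a selected window: it shares a position with its
    predecessor, hence is within two steps of a selected window and was a candidate. Revealed
    positions then lie around neighbours of selected windows, and there are at most
    [m * (k ^ 2 * Delta) * k * (k * Delta)] of these besides those around the root. *)
Lemma revealed_bound g root m : 0 < k -> ~~ grow g m (start root) [::] ->
  exists2 L : seq pos, size L <= 1 + k * Delta + m * (k ^ 2 * Delta) ^ 2 &
  forall q, (q = root \/
     exists p e, [/\ reach E g root p, e \in E, p.1 \in e & q \in window e p]) -> q \in L.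
Proof.
move=> k0; case/grow_maximal => [h /mapP[e]|I].
  by rewrite mem_filter => /andP[_ ?] ->.
rewrite /= cats0 => -[sI EI cI nI].
exists (root :: around root ++ flatten [seq flatten [seq flatten [seq around q | q <- win f]
  | f <- nbrs h] | h <- I]).
  rewrite /= size_cat -addnA add1n ltnS leq_add ?size_around //.
  apply: leq_trans (leq_mul sI (leqnn _)); apply: size_flatten_le => h /EI hh.
  apply: leq_trans (leq_mul (size_nbrs hh) (leqnn _)); apply: size_flatten_le => f /nbrs_E fE.
  have -> : k ^ 2 * Delta = k * (k * Delta) by ring.
  rewrite -{1}(size_win fE); apply: size_flatten_le => q _; exact: size_around.
have nonempty e p : e \in E -> win (e, p) != [::].
  by move=> eE; rewrite -size_eq0 size_win // -lt0n.
have hit e p : e \in E -> p.1 \in e -> has (mem (flatten (map win I))) (win (e, p)) ->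
    exists2 h, h \in I & (e, p) \in nbrs h.
  move=> eE pe /hasP[q qe /flattenP[_ /mapP[h hI ->] qh]]; exists h => //.
  exact: mem_nbrs qh qe.
have win_self e p : p.1 \in e -> p \in win (e, p).
  by move=> pe; apply/mapP; exists p.1; rewrite // /posn leqnn -surjective_pairing.
have reachP p : reach E g root p -> p = root \/
    exists h f, [/\ h \in I, f \in nbrs h & p \in win f].
  elim=> {p} [|p e w pR IH eE pe oe we]; first by left.
  right; suff [h hI eh] : exists2 h, h \in I & (e, p) \in nbrs h.
    by exists h, (e, p); split=> //; apply: map_f.
  apply: hit => //; case: IH => [pr|[h [f [hI fh pf]]]].
    by apply: cI => //; [rewrite pr; apply: map_f; rewrite mem_filter -pr pe|exact: nonempty].
  apply: (nI h (e, p)) => //; last exact: nonempty.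
  apply/flattenP; eexists; first exact: map_f fh.
  exact: mem_nbrs pf (win_self _ _ pe).
move=> q [->|[p [e [pR eE pe qw]]]]; first by rewrite mem_head.
have qa : q \in around p.
  apply/flattenP; exists (window e p) => //.
  by apply/mapP; exists e; rewrite // mem_filter pe.
rewrite in_cons mem_cat; case: (reachP _ pR) => [<-|[h [f [hI fh pf]]]].
  by rewrite qa orbT.
apply/orP; right; apply/orP; right.
apply/flattenP; eexists; first exact: map_f hI.
apply/flattenP; eexists; first exact: map_f fh.
by apply/flattenP; eexists; first exact: map_f pf.
Qed.

Section Tail.
Local Open Scope ring_scope.
Variable T : nat.

Definition in_range (p : pos) : bool := (p.1 < n)%N && (p.2 < T)%N.

Lemma mean_agree tb : uniq (keys tb) -> all in_range (keys tb) ->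
  mean (fun r : cube (n * T) => (agree tb (rb r))%:R) = (2 ^- size tb : rat).
Proof.
elim: tb => [|[p b] tb IH] /=; first by rewrite mean_cst expr0 invr1.
move=> /andP[ptb utb] /andP[/andP[p1 p2] htb].
rewrite (mean_setb (p.2 * n + p.1)).
have aE c (r : cube (n * T)) : agree tb (rb (setp r p c)) = agree tb (rb r).
  apply: eq_in_all => x xtb; rewrite rb_setp //; case: (eqVneq x.1 p) => // xp.
  by case/negP: ptb; rewrite -xp; apply: map_f.
under eq_mean => r do rewrite -/(setp r p _) rb_setp // eqxx aE.
under [X in _ + X]eq_mean => r do rewrite -/(setp r p _) rb_setp // eqxx aE.
rewrite exprS invfM -IH //; by case: b => /=; rewrite mean_cst; field.
Qed.

Lemma mean_ones A : uniq A ->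
  mean (fun r : cube (n * T) => (all (rb r) A)%:R) <= (2 ^- size A : rat).
Proof.
move=> uA; have [hA|/allPn[p pA hp]] := boolP (all in_range A).
  have := @mean_agree [seq (p, true) | p <- A].
  rewrite /keys -map_comp map_id size_map => <- //.
  by apply: le_mean => r; rewrite /agree all_map; under eq_all do rewrite /= -[rb r _]eqb_id.
rewrite (@eq_mean _ _ (fun=> 0)) ?mean_cst ?invr_ge0 ?exprn_ge0 // => r.
have /negbTE -> // : ~~ all (rb r) A; apply/allPn; exists p => //.
move: hp; rewrite negb_and -!leqNgt => /orP[h|/rb_out->//].
by rewrite /rb ltnNge h.
Qed.

(* The bound is a supersolution of the recursion in which the first candidate is either
   skipped or selected; a selected window costs [2 ^- k] and adds at most
   [(k ^ 2 * Delta) ^ 2] candidates. *)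
Lemma mean_grow (beta : rat) m c A :
  1 <= beta -> 4 * beta ^+ ((k ^ 2 * Delta) ^ 2) <= 2 ^+ k * (beta - 1) ->
  uniq A -> (forall h, h \in c -> h.1 \in E) ->
  mean (fun r : cube (n * T) => (all (rb r) A && grow (rb r) m c A)%:R)
    <= 2 ^- size A * 4 ^- m * beta ^+ size c.
Proof.
move=> b1 hb; elim: m c A => [|m IHm] c A uA cE.
  rewrite expr0 invr1 mulr1; apply: le_trans (_ : 2 ^- size A <= _).
    by apply: le_trans (mean_ones uA); apply: le_mean => r; rewrite andbT.
  by rewrite ler_peMr ?exprn_ege1 // invr_ge0 exprn_ge0.
elim: c A uA cE => [|h c IHc] A uA cE.
  rewrite (@eq_mean _ _ (fun=> 0)) ?mean_cst; last by move=> r; rewrite andbF.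
  by rewrite expr0 mulr1 mulr_ge0 // invr_ge0 exprn_ge0.
have hh : h.1 \in E by apply: cE; rewrite mem_head.
have cE' h' : h' \in c -> h'.1 \in E by move=> hc; apply: cE; rewrite in_cons hc orbT.
set q := 2 ^- size A; have q0 : 0 <= q by rewrite invr_ge0 exprn_ge0.
have p0 : 0 <= 4 ^- m :> rat by rewrite invr_ge0 exprn_ge0.
have bc : 0 <= beta ^+ size c by rewrite exprn_ge0 // (le_trans _ b1).
have k0 : 0 < (2 : rat) ^+ k by rewrite exprn_gt0.
have le2 : mean (fun r : cube (n * T) => ([&& all (rb r) A, all (rb r) (win h),
      ~~ has (mem A) (win h) & grow (rb r) m (c ++ nbrs2 h) (win h ++ A)])%:R)
    <= (2 ^+ k)^-1 * q * 4 ^- m * (beta ^+ size c * beta ^+ ((k ^ 2 * Delta) ^ 2)).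
  have [hA|hA] := boolP (has (mem A) (win h)).
    rewrite (@eq_mean _ _ (fun=> 0)) ?mean_cst; last by move=> r; rewrite !andbF.
    by rewrite !mulr_ge0 ?invr_ge0 ?exprn_ge0 // (le_trans _ b1).
  apply: le_trans (_ : 2 ^- size (win h ++ A) * 4 ^- m * beta ^+ size (c ++ nbrs2 h) <= _).
    apply: le_trans (IHm (c ++ nbrs2 h) (win h ++ A) _ _).
    - by apply: le_mean => r; rewrite all_cat -andbA andbCA.
    - rewrite cat_uniq uA andbT (uniq_window _ (regular_uniq hE hh)) /=.
      by rewrite has_sym.
    - by move=> f; rewrite mem_cat => /orP[/cE'//|/nbrs2_E].
  rewrite !size_cat size_win // exprD invfM !exprD.
  apply: ler_wpM2l; first by rewrite !mulr_ge0 // invr_ge0 ltW.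
  by apply: ler_wpM2l => //; rewrite ler_weXn2l // size_nbrs2.
apply: le_trans (_ : q * 4 ^- m.+1 * beta ^+ size c +
    (2 ^+ k)^-1 * q * 4 ^- m * (beta ^+ size c * beta ^+ ((k ^ 2 * Delta) ^ 2)) <= _).
  apply: le_trans (lerD (IHc A uA cE') le2); rewrite -meanD.
  apply: le_mean => r; rewrite growS andb_orr -natrD ler_nat.
  by case: (_ && grow _ _ _ _); case: (X in _ || X).
rewrite /= exprS !exprS invfM.
have hb' : 4 * beta ^+ ((k ^ 2 * Delta) ^ 2) / 2 ^+ k <= beta - 1.
  by rewrite ler_pdivrMr // [leRHS]mulrC.
have := ler_wpM2l (mulr_ge0 (mulr_ge0 q0 p0) bc) hb'.
move: (q) (4 ^- m) (beta ^+ size c) (beta ^+ _) (2 ^+ k)^-1 => q' x y z t ht.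
lra.
Qed.

End Tail.
End Growth.

(** * Accuracy of the estimated marginals *)

Lemma keys_cons x tb : keys (x :: tb) = x.1 :: keys tb.
Proof. by []. Qed.

(** If the root bit is [0] the value is decided at once. Positivity matters for the program: a
    binary shift of the empty digit list would not give the encoding of [0]. *)
Lemma cnt_gt0 fuel E v B : 0 < B -> 0 < cnt fuel E v B [::].
Proof.
case: B => // B _; have ev0 : ev fuel E [::] (v, 0) = Need (v, 0) by case: fuel.
rewrite /= ev0; case: B => [|B] /=; case: fuel {ev0} => [|fuel] /=; rewrite eqxx /=;
  by rewrite ltn_addr // expn_gt0.
Qed.

Section Marginal.
Local Open Scope ring_scope.
Variables (n k Delta : nat) (E : seq (seq nat)) (v B m : nat).
Hypotheses (hE : regular n k Delta E) (k0 : (0 < k)%N) (vn : (v < n)%N).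
Hypothesis hB : (1 + k * Delta + m * (k ^ 2 * Delta) ^ 2 < B)%N.

(** Each newly revealed bit lies at most one sweep further back, so revealed positions have sweep
    index below [B], and [value_rec] applies to all of them. *)
Let T := B.+2.
Let root : pos := (v, 0%N).

Let zero_mass tb : rat := mean (fun r : cube (n * T) =>
  isum E (fun S : cube n => (agree tb (rb r) && ~~ value T E (rb r) S root)%:R)).

Let bad_mass tb : rat := mean (fun r : cube (n * T) =>
  (agree tb (rb r) && grow E (rb r) m (start E root) [::])%:R).

Let total : rat := isum E (fun _ : cube n => 1).

Let total_ge0 : 0 <= total.
Proof. by apply: sumr_ge0 => S _; rewrite mulr1. Qed.

Let isum_split b (f : cube n -> bool) (r : cube (n * T)) tb p :
  isum E (fun S => (agree ((p, b) :: tb) (rb r) && f S)%:R) =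
  (rb r p == b)%:R * isum E (fun S => (agree tb (rb r) && f S)%:R).
Proof. by rewrite -isumZ; apply: eq_isum => S; rewrite /= -andbA -natrM mulnb. Qed.

Let in_range_keys tb : (size tb <= B)%N ->
  (forall q, q \in keys tb -> (q.1 < n)%N && (q.2 < size tb)%N) -> all (in_range n T) (keys tb).
Proof.
move=> stb htb; apply/allP => q /htb/andP[q1 q2]; rewrite /in_range q1.
exact: leq_trans q2 (leqW (leqW stb)).
Qed.

Let zero_mass_val tb c : (size tb <= B)%N -> uniq (keys tb) ->
  (forall q, q \in keys tb -> (q.1 < n)%N && (q.2 < size tb)%N) ->
  ev B.+1 E tb root = Val c -> zero_mass tb = (~~ c)%:R * (2 ^- size tb * total).
Proof.
move=> stb utb htb hc; rewrite -(mean_agree utb (in_range_keys stb htb)).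
have -> : (~~ c)%:R * (mean (fun r : cube (n * T) => (agree tb (rb r))%:R) * total) =
    (~~ c)%:R * total * mean (fun r : cube (n * T) => (agree tb (rb r))%:R) by ring.
rewrite -meanZ; apply: eq_mean => r; rewrite -mulrA [total * _]mulrC mulrA.
rewrite /total -isumZ; apply: eq_isum => S; rewrite mulr1.
case ag: (agree tb (rb r)); last by rewrite mulr0.
suff -> : value T E (rb r) S root = c by rewrite mulr1.
apply: (ev_val ag _ _ hc) => [q /htb/andP[q1 q2]|].
  apply: value_rec => //; last exact: regular_lt hE.
  by rewrite /T; move: (leq_trans q2 stb); rewrite !ltnS; exact: ltnW.
by rewrite ltnS; apply: leq_trans (count_size _ _) _; rewrite size_map.
Qed.

(** At a decided leaf both sides agree, since distinct keys give the table probability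
    [2 ^- size tb]. At an undecided leaf without budget, [B] distinct keys are more than
    [revealed_bound] allows, so all assignments compatible with the table are bad. *)
Lemma cnt_mass b tb : (size tb + b = B)%N -> uniq (keys tb) ->
  (forall q, q \in keys tb -> (q.1 < n)%N && (q.2 < size tb)%N) ->
  (forall (r : cube (n * T)) q, agree tb (rb r) -> q \in keys tb -> q = root \/
     exists p e, [/\ reach E (rb r) root p, e \in E, p.1 \in e & q \in window e p]) ->
  (cnt B.+1 E v b tb)%:R * total <= 2 ^+ B * zero_mass tb
    <= (cnt B.+1 E v b tb)%:R * total + 2 ^+ B * total * bad_mass tb.
Proof.
have B2 : 0 < (2 : rat) ^+ B by rewrite exprn_gt0.
have bad_ge0 tb' : 0 <= bad_mass tb'.
  by rewrite -[leLHS](mean_cst (n * T)); apply: le_mean => r; rewrite ler0n.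
have main_ge0 tb' : 0 <= 2 ^+ B * total * bad_mass tb' by rewrite mulr_ge0 // mulr_ge0 // ltW.
elim: b tb => [|b IH] tb sB utb htb rtb; have c0 := main_ge0 tb;
  (have stb : (size tb <= B)%N by rewrite -sB leq_addr);
  have val_case c := @zero_mass_val tb c stb utb htb.
- have := val_case; rewrite /= -/root.
  case: (seqand _ _) => [[]|p] hv.
  + by rewrite (hv _ erefl) /= !mul0r mulr0 lexx /= add0r.
  + rewrite (hv _ erefl) /= !mul1r.
    have -> : B = size tb by rewrite -sB addn0.
    rewrite mulrA mulfV ?expf_neq0 // mul1r lexx /=.
    by move: c0; rewrite -sB addn0 => c0; rewrite lerDl.
  + rewrite !mul0r add0r; apply/andP; split.
      rewrite mulr_ge0 ?(ltW B2) // -[leLHS](mean_cst (n * T)); apply: le_mean => r.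
      by apply: sumr_ge0 => S _; rewrite mulr_ge0.
    rewrite -mulrA ler_pM2l // -meanZ; apply: le_mean => r.
    rewrite mulrC /total -isumZ; apply: le_isum => S.
    case ag: (agree tb (rb r)); rewrite /= ?mul0r // mulr1 ler_nat.
    suff -> : grow E (rb r) m (start E root) [::] by rewrite leq_b1.
    apply/negPn/negP => /(revealed_bound hE k0)[L sL hL].
    suff : (size (keys tb) <= size L)%N.
      by rewrite size_map; move: sB hB sL; clear; lia.
    apply: uniq_leq_size => // q qk; apply: hL; exact: rtb ag qk.
- have := val_case; have := @ev_need E _ root tb B.+1 root; rewrite /= -/root.
  case: (seqand _ _) => [[]|p] hn hv.
  + by rewrite (hv _ erefl) /= !mul0r mulr0 lexx /= add0r.
  + rewrite (hv _ erefl) /= !mul1r.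
    have -> : (2 ^ b.+1)%:R = 2 ^+ B * 2 ^- size tb :> rat.
      by rewrite -sB exprD mulrAC mulfV ?expf_neq0 // mul1r natrX.
    by rewrite mulrA lexx /= lerDl.
  have need_p (r : cube (n * T)) : agree tb (rb r) -> p \notin keys tb /\ (p = root \/
      exists p' e, [/\ p' \in keys tb, reach E (rb r) root p', e \in E, p'.1 \in e &
                       p \in window e p']).
    by move=> ag; apply: (hn (rb r) p) => //; exact: reach_root.
  (* The requested position does not depend on [r], so a single assignment compatible with the table
     locates it; one exists because the table has positive probability. *)
  have [r0 ag0] : exists r0 : cube (n * T), agree tb (rb r0).
    case: (pickP (fun r : cube (n * T) => agree tb (rb r))) => [r ?|no]; first by exists r.
    have := mean_agree utb (in_range_keys stb htb); under eq_mean do rewrite no.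
    rewrite mean_cst => /esym/eqP; by rewrite invr_eq0 expf_eq0 andbF.
  have [pk hp0] := need_p _ ag0.
  have IHc c : (cnt B.+1 E v b ((p, c) :: tb))%:R * total <= 2 ^+ B * zero_mass ((p, c) :: tb)
      <= (cnt B.+1 E v b ((p, c) :: tb))%:R * total + 2 ^+ B * total * bad_mass ((p, c) :: tb).
    apply: IH.
    - by rewrite /= -sB addSnnS.
    - by rewrite keys_cons /= pk.
    - move=> q; rewrite keys_cons in_cons => /predU1P[->|/htb/andP[-> /=]]; last exact: ltnW.
      case: hp0 => [->|[p' [e [/htb/andP[p1 p2] _ eE pe /mapP[w we ->]]]]] /=; first by rewrite vn.
      rewrite [(w < n)%N](allP (regular_lt hE eE) _ we) /= ltnS; case: (w <= p'.1)%N => //; exact: ltnW.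
    - move=> r q /= /andP[_ ag]; rewrite in_cons => /predU1P[->|qk]; last exact: rtb ag qk.
      case: (need_p _ ag) => _ [->|[p' [e [_ ? ? ? ?]]]]; [by left|right].
      by exists p', e.
  have -> : zero_mass tb = zero_mass ((p, false) :: tb) + zero_mass ((p, true) :: tb).
    rewrite /zero_mass -meanD; apply: eq_mean => r; rewrite !isum_split -mulrDl.
    by case: (rb r p); rewrite /= ?addr0 ?add0r mul1r.
  have -> : bad_mass tb = bad_mass ((p, false) :: tb) + bad_mass ((p, true) :: tb).
    rewrite /bad_mass -meanD; apply: eq_mean => r /=.
    by case: (rb r p); rewrite /= ?addr0 ?add0r.
  have /andP[l0 u0] := IHc false; have /andP[l1 u1] := IHc true.
  rewrite natrD mulrDl 2!mulrDr; apply/andP; split; first exact: lerD.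
  by rewrite addrACA; exact: lerD.
Qed.

End Marginal.

(** * From the marginals to the number of independent sets *)

Section Estimate.
Local Open Scope ring_scope.

Lemma bernoulli (x : rat) h : 0 <= x <= 1 -> 1 - h%:R * x <= (1 - x) ^+ h.
Proof.
move=> /andP[x0 x1]; elim: h => [|h IH]; first by rewrite mul0r subr0 expr0.
rewrite exprS; apply: le_trans (_ : (1 - x) * (1 - h%:R * x) <= _); last first.
  by apply: ler_wpM2l; rewrite ?subr_ge0.
have : 0 <= h%:R * (x * x) by rewrite !mulr_ge0.
rewrite -natr1; nra.
Qed.

(** The inverse of [1 + 1/d] is [1 - x] with [x = 1/(d + 1)]. Bernoulli's inequality for half the
    exponent gives [1/2], and squaring gives [1/4]. *)
Lemma one_plus_inv_pow d : (0 < d)%N -> (1 + d%:R^-1) ^+ d <= 4 :> rat.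
Proof.
move=> d0; set x : rat := d.+1%:R^-1.
have dR : 0 < d%:R :> rat by rewrite ltr0n.
have x01 : 0 <= x <= 1 by rewrite /x invr_ge0 ler0n /= invf_le1 ?ler1n.
have yE : 1 + d%:R^-1 = (1 - x)^-1.
  rewrite /x -natr1; field; rewrite natr1 pnatr_eq0 gt_eqF //=; lra.
have half : 1 / 2 <= (1 - x) ^+ (uphalf d).
  apply: le_trans (bernoulli _ x01).
  have : (uphalf d)%:R * x <= 1 / 2.
    have : (2 * uphalf d)%:R <= d.+1%:R :> rat by rewrite ler_nat uphalfE; lia.
    by rewrite natrM /x ler_pdivrMr //; lra.
  lra.
have le4 : 1 / 4 <= (1 - x) ^+ d.
  apply: le_trans (_ : ((1 - x) ^+ (uphalf d)) ^+ 2 <= _); first by rewrite expr2; nra.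
  rewrite -exprM; apply: ler_wiXn2l; [lra|lra|rewrite uphalfE; lia].
rewrite yE exprVn -[leRHS]invrK lef_pV2 ?posrE //; lra.
Qed.

Variables (n k Delta B m : nat).
Hypotheses (k0 : (0 < k)%N) (D0 : (0 < Delta)%N).
Hypothesis hk : (16 * (k ^ 2 * Delta) ^ 2 <= 2 ^ k)%N.
Hypothesis hB : (1 + k * Delta + m * (k ^ 2 * Delta) ^ 2 < B)%N.
Implicit Types (E : seq (seq nat)).

Definition nind E : rat := isum E (fun _ : cube n => 1).

Lemma tail_bound E v : regular n k Delta E ->
  mean (fun r : cube (n * B.+2) => (grow E (rb r) m (start E (v, 0%N)) [::])%:R)
    <= 4 * 4 ^- m.
Proof.
move=> hE; set d := ((k ^ 2 * Delta) ^ 2)%N.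
have d0 : (0 < d)%N by rewrite !expn_gt0 muln_gt0 expn_gt0 k0 D0.
have dR : 0 < d%:R :> rat by rewrite ltr0n.
set beta : rat := 1 + d%:R^-1.
have b1 : 1 <= beta by rewrite lerDl invr_ge0 ltW.
have bd : beta ^+ d <= 4 := one_plus_inv_pow d0.
have hb : 4 * beta ^+ d <= 2 ^+ k * (beta - 1).
  apply: le_trans (_ : 16 <= _); first lra.
  have : (16 * d)%:R <= (2 ^ k)%:R :> rat by rewrite ler_nat.
  by rewrite natrM natrX /beta addrC addKr ler_pdivlMr.
have sE h : h \in start E (v, 0%N) -> h.1 \in E.
  by case/mapP=> e; rewrite mem_filter => /andP[_ ?] ->.
have := @mean_grow n k Delta E hE B.+2 beta m (start E (v, 0%N)) [::] b1 hb isT sE.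
move/le_trans; apply; rewrite /= expr0 invr1 mul1r mulrC ler_wpM2r ?invr_ge0 ?exprn_ge0 //.
(* There are at most [Delta <= d] starting windows, hence the leading factor [4]. *)
apply: le_trans bd; apply: ler_weXn2l => //; rewrite size_map.
have k2 : (0 < k ^ 2)%N by rewrite expn_gt0 k0.
apply: leq_trans (size_edges_at hE _) (leq_trans (leq_pmull Delta k2) _).
by rewrite /d -mulnn leq_pmulr // muln_gt0 k2 D0.
Qed.

(** When [v] is absent its edges impose nothing; once they are removed, [v] is a free vertex and is
    absent from half of the sets. *)
Lemma nind_remove E v : (v < n)%N ->
  isum E (fun S : cube n => (~~ cb S v)%:R) = nind [seq e <- E | v \notin e] / 2.
Proof.
move=> vn; apply: (@mulfI _ (2 : rat)) => //.
rewrite mulrCA mulfV // mulr1 /isum -(sum_setb v); apply: eq_bigr => S _.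
rewrite !cb_setb eqxx vn /= mulr0 addr0 !mulr1; congr (_%:R).
rewrite /indep all_filter; congr nat_of_bool; apply: eq_all => e /=.
have [ve|ve] /= := boolP (v \in e).
  by apply/allPn; exists v; rewrite // cb_setb eqxx vn.
congr (~~ _); apply: eq_in_all => w we; rewrite cb_setb; case: eqP => // wv.
by rewrite -wv we in ve.
Qed.

Lemma nind_le_remove E v : nind E <= nind [seq e <- E | v \notin e].
Proof.
apply: ler_sum => S _; rewrite !mulr1 ler_nat /indep all_filter.
case: (boolP (all _ E)) => //= /allP h; rewrite [X in nat_of_bool X](_ : _ = true) //.
by apply/allP => e /h he; apply/implyP.
Qed.

(** The constant [8] is twice that of the tail bound, because the error is measured against
    [N' / 2], which is at least [nind E / 2]. *)
Lemma marginal_estimate E v : regular n k Delta E -> (v < n)%N ->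
  let a : rat := (cnt B.+1 E v B [::])%:R in
  let N' := nind [seq e <- E | v \notin e] in
  2 ^+ B / 2 * N' * (1 - 8 * 4 ^- m) <= a * nind E <= 2 ^+ B / 2 * N'.
Proof.
move=> hE vn; cbv zeta; set a := (cnt _ _ _ _ _)%:R; set N' := nind (filter _ _).
have := @cnt_mass n k Delta E v B m hE k0 vn hB B [::].
rewrite add0n => /(_ erefl isT (fun q => _) (fun r q _ => _)) /= h.
have {h} /andP[lo hi] := h (fun=> ltac:(by [])) (fun _ _ => ltac:(by [])).
have mv := @mean_value n B.+2 E v (fun b => (~~ b)%:R) vn isT.
rewrite /= in lo hi mv; rewrite mv nind_remove // -/N' in lo hi.
have tb := tail_bound v hE.
have leN : nind E <= N' := nind_le_remove E v.
have N0 : 0 <= nind E by apply: sumr_ge0 => S _; rewrite mulr1.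
have B2 : 0 < (2 : rat) ^+ B by rewrite exprn_gt0.
rewrite -/(nind E) -/a in lo hi.
set bad := mean _ in hi tb.
apply/andP; split; last by lra.
have m0 : 0 <= 4 ^- m :> rat by rewrite invr_ge0 exprn_ge0.
have h1 : nind E * bad <= N' * (4 * 4 ^- m).
  apply: le_trans (ler_wpM2l N0 tb) _; apply: ler_wpM2r => //; by rewrite mulr_ge0.
have := ler_wpM2l (ltW B2) h1.
lra.
Qed.

Lemma regular_filter E (P : pred (seq nat)) : regular n k Delta E ->
  regular n k Delta [seq e <- E | P e].
Proof.
case=> h1 h2 h3 h4; split=> [e|e|e|u];
  rewrite ?mem_filter; try (by move=> /andP[_ eE]; auto).
apply: leq_trans (h4 u); rewrite count_filter; apply: sub_count => e /= /andP[] //.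
Qed.

Lemma nind_gt0 E : regular n k Delta E -> 0 < nind E.
Proof.
move=> hE; pose S0 : cube n := [ffun=> false].
rewrite /nind /isum (bigD1 S0) //= ltr_wpDr ?sumr_ge0 // => [S _|].
  by rewrite mulr1.
rewrite mulr1 ltr0n lt0b; apply/allP => e eE; apply/allPn.
case: e eE => [|w e] eE; first by move: k0; rewrite -(regular_size hE eE).
exists w; rewrite ?mem_head // /cb; case: insubP => // i _ _; by rewrite ffunE.
Qed.

(** A telescoping product: the counts of the intermediate hypergraphs are positive and cancel. *)
Lemma stage_bounds E vs den : regular n k Delta E -> all (gtn n) vs -> 8 * 4 ^- m <= 1 :> rat ->
  let N' := nind [seq e <- E | ~~ has (mem vs) e] in
  den%:R * ((2 ^+ B / 2) ^+ size vs * N') * (1 - 8 * 4 ^- m) ^+ size vs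
    <= (stage B vs E den)%:R * nind E <= den%:R * ((2 ^+ B / 2) ^+ size vs * N').
Proof.
move=> hE + hm; elim: vs E den hE => [|v vs IH] E den hE.
  move=> _ /=; rewrite !expr0 mulr1 mul1r (_ : [seq e <- E | _] = E) ?lexx //.
  by rewrite -[RHS]filter_predT; apply: eq_filter => e; rewrite has_pred0.
move=> /= /andP[vn vsn]; set E' := [seq e <- E | v \notin e].
have -> : [seq e <- E | ~~ has (mem (v :: vs)) e] = [seq e <- E' | ~~ has (mem vs) e].
  rewrite -filter_predI; apply: eq_filter => e /=.
  by rewrite -has_pred1 -negb_or orbC -has_predU; congr (~~ _); apply: eq_has => w; rewrite /= inE.
set N' := nind _; set a := cnt _ _ _ _ _.
have hE' : regular n k Delta E' := regular_filter _ hE.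
have /andP[lo hi] := IH E' (den * a)%N hE' vsn.
have /andP[la ha] := marginal_estimate hE vn; rewrite -/a -/E' in la ha.
rewrite -/N' natrM in lo hi; set X := (2 ^+ B / 2 : rat) in la ha lo hi *.
set eta : rat := 8 * 4 ^- m in hm lo la *.
set st : rat := (stage _ _ _ _)%:R in lo hi *.
have X0 : 0 <= X by rewrite divr_ge0 // exprn_ge0.
have N'0 : 0 <= N' := ltW (nind_gt0 (regular_filter _ hE')).
have E0 := ltW (nind_gt0 hE).
have eta0 : 0 <= 1 - eta by rewrite subr_ge0.
rewrite !exprS; set P := X ^+ size vs in lo hi *; set Q := (1 - eta) ^+ size vs in lo *.
have P0 : 0 <= P by rewrite exprn_ge0.
have Q0 : 0 <= Q by rewrite exprn_ge0.
have dP : 0 <= den%:R * (P * N') by rewrite !mulr_ge0.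
apply/andP; split; rewrite -(ler_pM2r (nind_gt0 hE')).
- by have := ler_wpM2r E0 lo; have := ler_wpM2l (mulr_ge0 dP Q0) la; lra.
- by have := ler_wpM2r E0 hi; have := ler_wpM2l dP ha; lra.
Qed.

End Estimate.

Section Accuracy.
Local Open Scope ring_scope.

Lemma nind_nil n : nind n [::] = 2 ^+ n.
Proof.
rewrite /nind /isum; under eq_bigr do rewrite mulr1.
by rewrite sumr_const card_ffun card_bool card_ord natrX.
Qed.

Lemma stage_accuracy n k Delta B m E (eps : rat) : (0 < k)%N -> (0 < Delta)%N ->
  (16 * (k ^ 2 * Delta) ^ 2 <= 2 ^ k)%N ->
  (1 + k * Delta + m * (k ^ 2 * Delta) ^ 2 < B)%N ->
  regular n k Delta E -> 0 < eps < 1 -> (0 < n)%N -> 16 * n%:R <= eps * 4 ^+ m ->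
  (0 < stage B (iota 0 n) E 1)%N /\
  (1 - eps) * nind n E <= (2 ^ (B * n))%:R / (stage B (iota 0 n) E 1)%:R <= (1 + eps) * nind n E.
Proof.
move=> k0 D0 hk hB hE /andP[e0 e1] n0 hm.
have m4 : 0 < (4 : rat) ^+ m by rewrite exprn_gt0.
have nR : 1 <= n%:R :> rat by rewrite ler1n.
set x : rat := 8 * 4 ^- m.
have nx : n%:R * x <= eps / 2 by rewrite /x mulrA ler_pdivrMr //; lra.
have x0 : 0 <= x by rewrite /x mulr_ge0 // invr_ge0 ltW.
have x1 : x <= 1 by nra.
have vs_n : all (gtn n) (iota 0 n) by apply/allP => i; rewrite mem_iota.
have := stage_bounds k0 D0 hk hB 1 hE vs_n x1; rewrite /= size_iota mul1r -/x.
have -> : [seq e <- E | ~~ has (mem (iota 0 n)) e] = [::].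
  rewrite -(filter_pred0 E); apply: eq_in_filter => -[|w e] eE.
    by move: k0; rewrite -(regular_size hE eE).
  apply/negbTE; rewrite negbK; apply/hasP; exists w; rewrite ?mem_head //=.
  by rewrite mem_iota; have /andP[] := regular_lt hE eE.
(* No edge survives the last stage, and the [2 ^ n] remaining sets cancel the [n] factors [1/2] of
   the marginals. *)
rewrite nind_nil -exprMn divfK //; set st := stage _ _ _ _; set Z := nind n E.
rewrite -exprM -natrX; set num : rat := (2 ^ (B * n))%:R.
have num0 : 0 < num by rewrite ltr0n expn_gt0.
have Z0 : 0 < Z := nind_gt0 k0 hE.
case/andP=> lo hi.
have pow_ge : 1 - eps / 2 <= (1 - x) ^+ n.
  by apply: le_trans (bernoulli _ _); [lra|rewrite x0 x1].
have lo' : num * (1 - eps / 2) <= st%:R * Z.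
  by apply: le_trans lo; apply: ler_wpM2l => //; exact: ltW.
have st0 : 0 < st%:R :> rat.
  by rewrite -(pmulr_lgt0 _ Z0); apply: lt_le_trans lo'; rewrite mulr_gt0 //; lra.
split; first by rewrite -(ltr0n rat).
rewrite ler_pdivlMr // ler_pdivrMr //; apply/andP; split.
  apply: le_trans hi; rewrite [st%:R * Z]mulrC -mulrA ler_piMl ?mulr_ge0 ?ltW //; lra.
(* A loss of [eps / 2] in the denominator costs at most a factor [1 + eps], as [eps < 1]. *)
have : num * 1 <= num * ((1 + eps) * (1 - eps / 2)) by apply: ler_wpM2l; [exact: ltW|nra].
have : (1 + eps) * (num * (1 - eps / 2)) <= (1 + eps) * (st%:R * Z).
  by apply: ler_wpM2l => //; lra.
lra.
Qed.

End Accuracy.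

(** * Encoded hypergraphs as lists of edges *)

Section HypergraphLink.
Variables (H : hypergraph) (s : seq (seq 'I_(num_vertices H))).
Let n := num_vertices H.
Hypotheses (us : all uniq s).
Hypothesis ps : perm_eq [seq [set v in e] | e <- s] (enum (hyperedges H)).

Definition edge_lists : seq (seq nat) := [seq [seq val v | v <- e] | e <- s].

Lemma edge_lists_regular k Delta : k_uniform k H -> max_degree H = Delta ->
  regular n k Delta edge_lists.
Proof.
move=> kH dH; split.
- by move=> _ /mapP[e es ->]; rewrite (map_inj_uniq val_inj) (allP us).
- move=> _ /mapP[e es ->]; rewrite size_map -(card_uniqP (allP us _ es)).
  rewrite -(kH [set v in e]); first by rewrite cardsE.
  by rewrite -mem_enum -(perm_mem ps) map_f.
- by move=> _ /mapP[e es ->]; rewrite all_map; apply/allP => v _ /=.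
- move=> u; rewrite count_map; have [un|nu] := ltnP u n; last first.
    rewrite (@eq_count _ _ pred0) ?count_pred0 // => e /=.
    by apply/negP => /mapP[v _ uv]; move: nu; rewrite uv leqNgt ltn_ord.
  have -> : count (preim (map val) (fun e => u \in e)) s =
      count (fun e : {set 'I_n} => Ordinal un \in e) [seq [set v in e] | e <- s].
    rewrite count_map; apply: eq_count => e /=; rewrite inE.
    by rewrite -(mem_map val_inj).
  rewrite (permP ps) -dH; apply: leq_trans (leq_bigmax (Ordinal un)).
  rewrite /degree cardE -size_filter /enum_mem -filter_predI eq_leq //; congr size.
  by apply: eq_filter => e; rewrite /= !inE andbC.
Qed.

Lemma nind_edge_lists : nind n edge_lists = (num_independent H)%:R%R.
Proof.
pose f (S : cube n) : {set 'I_n} := [set v | S v].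
have f_bij : bijective f.
  exists (fun A : {set 'I_n} => [ffun v => v \in A] : cube n) => [S|A].
    by apply/ffunP => v; rewrite ffunE inE.
  by apply/setP => v; rewrite inE ffunE.
rewrite /nind /isum /num_independent -sum1_card natr_sum [RHS]big_mkcond /=.
rewrite [RHS](reindex f) /=; last exact: onW_bij.
apply: eq_bigr => S _; rewrite mulr1 inE.
suff -> : indep edge_lists S = weak_independent (f S) by case: weak_independent.
rewrite /indep all_map; apply/allP/forall_inP => h e.
  rewrite -mem_enum -(perm_mem ps) => /mapP[l ls ->].
  have := h l ls; rewrite /= all_map; apply: contra => /subsetP hl; apply/allP => v vl /=.
  by rewrite cb_ord; have := hl v; rewrite !inE; apply.
move=> es; have := h [set v in e]; rewrite -mem_enum -(perm_mem ps) map_f // => /(_ isT).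
rewrite /= all_map; apply: contra => /allP he; apply/subsetP => v; rewrite !inE => /he /=.
by rewrite cb_ord.
Qed.

End HypergraphLink.

(** * Costed evaluation *)

(** Upper bounds in place of exact step counts let the rules compose, with the arithmetic postponed
    to one final inequality. *)
Definition leval p x e v T : Prop := exists2 t, eval p x e v t & t <= T.

Section Leval.
Variable p : program.

Lemma leval_arg x : leval p x EArg x 1.
Proof. by exists 1; first exact: eval_arg. Qed.

Lemma leval_nil x : leval p x ENil leaf 1.
Proof. by exists 1; first exact: eval_nil. Qed.

Lemma leval_cons x e1 e2 v1 v2 T1 T2 : leval p x e1 v1 T1 -> leval p x e2 v2 T2 ->
  leval p x (ECons e1 e2) (node v1 v2) (T1 + T2).+1.
Proof.
move=> [t1 h1 l1] [t2 h2 l2]; exists (t1 + t2).+1; first exact: eval_cons.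
by rewrite ltnS leq_add.
Qed.

Lemma leval_hd x e v w T : leval p x e v T -> hd v = w -> leval p x (EHd e) w T.+1.
Proof. by move=> [t h l] <-; exists t.+1; first exact: eval_hd. Qed.

Lemma leval_tl x e v w T : leval p x e v T -> tl v = w -> leval p x (ETl e) w T.+1.
Proof. by move=> [t h l] <-; exists t.+1; first exact: eval_tl. Qed.

Lemma leval_if x e e1 e2 c v T0 T1 : leval p x e c T0 ->
  leval p x (if c is node _ _ then e1 else e2) v T1 ->
  leval p x (EIf e e1 e2) v (T0 + T1).+1.
Proof.
move=> [t h l] [t1 h1 l1]; exists (t + t1).+1; last by rewrite ltnS leq_add.
by case: c h h1 => [|y z] h h1; [apply: eval_if_false|apply: eval_if_true; first exact: h].
Qed.

Definition calls f y v T : Prop := leval p y (nth ENil p f) v T.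

Lemma leval_call x f e y v T T' : leval p x e y T -> calls f y v T' ->
  leval p x (ECall f e) v (T + T').+1.
Proof.
move=> [t h l] [t' h' l']; exists (t + t').+1; last by rewrite ltnS leq_add.
exact: eval_call h h'.
Qed.

Lemma leval_sub x e v0 v T0 T : leval p x e v0 T0 -> v0 = v -> T0 <= T -> leval p x e v T.
Proof. by move=> [t h l] <- le0; exists t => //; apply: leq_trans le0. Qed.

End Leval.

Ltac lsimp := cbn [enc_bool].
Ltac lspec := fail.
Ltac lcall := first
  [ match goal with IH : _ |- calls _ ?f _ _ _ =>
      lazymatch type of IH with context [calls _ f _ _ _] => eapply IH end end
  | lspec | idtac ].
Ltac lbool := repeat match goal with
  | H : _ = true |- context [enc_bool _] => rewrite H
  | H : _ = false |- context [enc_bool _] => rewrite H end.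
(** Symbolic execution along the shape of the expression. Values and times remain existential;
    called functions are resolved by hypotheses or by [lspec], which is extended as specifications
    become available. *)
Ltac lrun :=
  first [ match goal with H : leval _ _ ?e _ _ |- leval _ _ ?e _ _ => eapply H end |
  lazymatch goal with
  | |- leval _ _ EArg _ _ => eapply leval_arg
  | |- leval _ _ ENil _ _ => eapply leval_nil
  | |- leval _ _ (ECons _ _) _ _ => eapply leval_cons; [lrun|lrun]
  | |- leval _ _ (EHd _) _ _ => eapply leval_hd; [lrun|lsimp; cbn [hd tl]; reflexivity]
  | |- leval _ _ (ETl _) _ _ => eapply leval_tl; [lrun|lsimp; cbn [hd tl]; reflexivity]
  | |- leval _ _ (EIf _ _ _) _ _ => eapply leval_if; [lrun|lbool; lsimp; cbv iota; lrun]
  | |- leval _ _ (ECall _ _) _ _ => eapply leval_call; [lrun|lcall]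
  | |- _ => idtac
  end ].
Ltac lgo := eapply leval_sub; [lrun| |].

(** * The program *)

Notation f_eq := 1. Notation f_le := 2. Notation f_mem := 3. Notation f_look := 4.
Notation f_pos := 5. Notation f_scan := 6. Notation f_neg := 7. Notation f_sub := 8.
Notation f_edge := 9. Notation f_edges := 10. Notation f_ev := 11. Notation f_shift := 12.
Notation f_inc := 13. Notation f_add := 14. Notation f_cnt := 15. Notation f_filt := 16.
Notation f_stage := 17. Notation f_num := 18. Notation f_dbl := 19. Notation f_conv := 20.
Notation f_convs := 21. Notation f_convss := 22. Notation f_last := 23. Notation f_lead := 24.
Notation f_app := 25. Notation f_times := 26. Notation f_solve := 27.

Definition etrue : expr := ECons ENil ENil.
(* Without local bindings [e] is evaluated twice when its value is not [leaf]. *)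
Definition eor (e e' : expr) : expr := EIf e e e'.

(* The comments show the argument of each function, a right-nested tuple. *)

(* (x, y) *)
Definition b_eq : expr :=
  EIf (EHd EArg)
    (EIf (ETl EArg) (ECall f_eq (ECons (ETl (EHd EArg)) (ETl (ETl EArg)))) ENil)
    (EIf (ETl EArg) ENil etrue).

(* (x, y) *)
Definition b_le : expr :=
  EIf (EHd EArg)
    (EIf (ETl EArg) (ECall f_le (ECons (ETl (EHd EArg)) (ETl (ETl EArg)))) ENil)
    etrue.

(* (u, e) *)
Definition b_mem : expr :=
  EIf (ETl EArg)
    (EIf (ECall f_eq (ECons (EHd EArg) (EHd (ETl EArg)))) etrue
       (ECall f_mem (ECons (EHd EArg) (ETl (ETl EArg)))))
    ENil.

(* ((u, s), table) *)
Definition b_look : expr :=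
  let rec := ECall f_look (ECons (EHd EArg) (ETl (ETl EArg))) in
  EIf (ETl EArg)
    (EIf (ECall f_eq (ECons (EHd (EHd EArg)) (EHd (EHd (EHd (ETl EArg))))))
       (EIf (ECall f_eq (ECons (ETl (EHd EArg)) (ETl (EHd (EHd (ETl EArg))))))
          (ETl (EHd (ETl EArg))) rec)
       rec)
    (ECons (EHd EArg) ENil).

(* ((u, s), w) *)
Definition b_pos : expr :=
  ECons (ETl EArg)
    (EIf (ECall f_le (ECons (ETl EArg) (EHd (EHd EArg)))) (ETl (EHd EArg))
       (ECons ENil (ETl (EHd EArg)))).

(* (p, e, table) *)
Definition b_scan : expr :=
  EIf (EHd (ETl EArg))
    (eor (ECall f_look (ECons (ECall f_pos (ECons (EHd EArg) (EHd (EHd (ETl EArg)))))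
                              (ETl (ETl EArg))))
         (ECall f_scan (ECons (EHd EArg) (ECons (ETl (EHd (ETl EArg))) (ETl (ETl EArg))))))
    ENil.

(* a result: [leaf] is [Val true], [node leaf leaf] is [Val false] *)
Definition b_neg : expr := EIf EArg (EIf (EHd EArg) EArg ENil) etrue.

(* (p, e, table, E, fuel) *)
Definition b_sub : expr :=
  let rec := ECall f_sub (ECons (EHd EArg) (ECons (ETl (EHd (ETl EArg))) (ETl (ETl EArg)))) in
  EIf (EHd (ETl EArg))
    (EIf (ECall f_eq (ECons (EHd (EHd (ETl EArg))) (EHd (EHd EArg)))) rec
       (eor (ECall f_ev (ECons (ECall f_pos (ECons (EHd EArg) (EHd (EHd (ETl EArg)))))
                               (ETl (ETl EArg))))
            rec))
    ENil.

(* (p, e, table, E, fuel) *)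
Definition b_edge : expr :=
  EIf (ECall f_mem (ECons (EHd (EHd EArg)) (EHd (ETl EArg))))
    (ECall f_neg
       (eor (ECall f_scan (ECons (EHd EArg) (ECons (EHd (ETl EArg)) (EHd (ETl (ETl EArg))))))
            (ECall f_sub EArg)))
    ENil.

(* (p, edges, table, E, fuel) *)
Definition b_edges : expr :=
  EIf (EHd (ETl EArg))
    (eor (ECall f_edge (ECons (EHd EArg) (ECons (EHd (EHd (ETl EArg))) (ETl (ETl EArg)))))
         (ECall f_edges (ECons (EHd EArg) (ECons (ETl (EHd (ETl EArg))) (ETl (ETl EArg))))))
    ENil.

(* (p, table, E, fuel) *)
Definition b_ev : expr :=
  eor (ECall f_look (ECons (EHd EArg) (EHd (ETl EArg))))
    (EIf (ETl (ETl (ETl EArg)))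
       (ECall f_edges (ECons (EHd EArg) (ECons (EHd (ETl (ETl EArg)))
          (ECons (EHd (ETl EArg)) (ECons (EHd (ETl (ETl EArg))) (ETl (ETl (ETl (ETl EArg)))))))))
       ENil).

(* (b, x) *)
Definition b_shift : expr :=
  EIf (EHd EArg) (ECons ENil (ECall f_shift (ECons (ETl (EHd EArg)) (ETl EArg)))) (ETl EArg).

Definition b_inc : expr :=
  EIf EArg
    (EIf (EHd EArg) (ECons ENil (ECall f_inc (ETl EArg))) (ECons etrue (ETl EArg)))
    (ECons etrue ENil).

(* (carry, x, y) *)
Definition b_add : expr :=
  let x := EHd (ETl EArg) in let y := ETl (ETl EArg) in
  let rec c := ECall f_add (ECons c (ECons (ETl x) (ETl y))) in
  let r0 := rec ENil in let r1 := rec etrue in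
  EIf x
    (EIf y
       (EIf (EHd EArg)
          (EIf (EHd x) (EIf (EHd y) (ECons etrue r1) (ECons ENil r1))
                       (EIf (EHd y) (ECons ENil r1) (ECons etrue r0)))
          (EIf (EHd x) (EIf (EHd y) (ECons ENil r1) (ECons etrue r0))
                       (EIf (EHd y) (ECons etrue r0) (ECons ENil r0))))
       (EIf (EHd EArg) (ECall f_inc x) x))
    (EIf (EHd EArg) (ECall f_inc y) y).

(* (b, table, v, E, fuel, den) *)
Definition b_cnt : expr :=
  let ctx := ETl (ETl EArg) in
  let r := ECall f_ev (ECons (ECons (EHd ctx) ENil) (ECons (EHd (ETl EArg))
             (ECons (EHd (ETl ctx)) (EHd (ETl (ETl ctx)))))) in
  let rec c := ECall f_cnt (ECons (ETl (EHd EArg))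
                 (ECons (ECons (ECons (EHd r) c) (EHd (ETl EArg))) ctx)) in
  EIf r
    (EIf (EHd r)
       (EIf (EHd EArg) (ECall f_add (ECons ENil (ECons (rec etrue) (rec ENil)))) ENil)
       (ECall f_shift (ECons (EHd EArg) (ETl (ETl (ETl ctx))))))
    ENil.

(* (v, E) *)
Definition b_filt : expr :=
  let rec := ECall f_filt (ECons (EHd EArg) (ETl (ETl EArg))) in
  EIf (ETl EArg)
    (EIf (ECall f_mem (ECons (EHd EArg) (EHd (ETl EArg)))) rec (ECons (EHd (ETl EArg)) rec))
    ENil.

(* (vs, E, den, B) *)
Definition b_stage : expr :=
  let vs := EHd EArg in let E := EHd (ETl EArg) in
  let den := EHd (ETl (ETl EArg)) in let B := ETl (ETl (ETl EArg)) in
  EIf vs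
    (ECall f_stage (ECons (ETl vs) (ECons (ECall f_filt (ECons (EHd vs) E))
       (ECons (ECall f_cnt (ECons B (ECons ENil (ECons (EHd vs) (ECons E
                 (ECons (ECons ENil B) den)))))) B))))
    den.

(* (vs, B) *)
Definition b_num : expr :=
  EIf (EHd EArg)
    (ECall f_shift (ECons (ETl EArg) (ECall f_num (ECons (ETl (EHd EArg)) (ETl EArg)))))
    (ECons etrue ENil).

Definition b_dbl : expr := EIf EArg (ECons ENil (ECons ENil (ECall f_dbl (ETl EArg)))) ENil.

Definition b_conv : expr :=
  let rec := ECall f_dbl (ECall f_conv (ETl EArg)) in
  EIf EArg (EIf (EHd EArg) (ECons ENil rec) rec) ENil.

Definition b_convs : expr :=
  EIf EArg (ECons (ECall f_conv (EHd EArg)) (ECall f_convs (ETl EArg))) ENil.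

Definition b_convss : expr :=
  EIf EArg (ECons (ECall f_convs (EHd EArg)) (ECall f_convss (ETl EArg))) ENil.

Definition b_last : expr := EIf (ETl EArg) (ECall f_last (ETl EArg)) (EHd EArg).

Definition b_lead : expr := EIf (EHd (EHd EArg)) ENil (ECons ENil (ECall f_lead (ETl EArg))).

(* (x, y) *)
Definition b_app : expr :=
  EIf (EHd EArg) (ECons ENil (ECall f_app (ECons (ETl (EHd EArg)) (ETl EArg)))) (ETl EArg).

Definition b_times (K : nat) : expr := iter K (fun e => ECall f_app (ECons EArg e)) ENil.

(* (B, vs, E) *)
Definition b_solve : expr :=
  let vs := EHd (ETl EArg) in
  ECons (ECall f_num (ECons vs (EHd EArg)))
    (ECall f_stage (ECons vs (ECons (ETl (ETl EArg)) (ECons (ECons etrue ENil) (EHd EArg))))).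

(* ((vertices, edges), accuracy) *)
Definition b_main : expr :=
  let m := iter 5 (ECons ENil)
    (ECall f_app (ECons (ECall f_last (EHd (EHd EArg))) (ECall f_lead (ETl EArg)))) in
  ECall f_solve (ECons (ECall f_times m)
    (ECons (ECall f_convs (EHd (EHd EArg))) (ECall f_convss (ETl (EHd EArg))))).

Definition prog (K : nat) : program :=
  [:: b_main; b_eq; b_le; b_mem; b_look; b_pos; b_scan; b_neg; b_sub; b_edge; b_edges; b_ev;
      b_shift; b_inc; b_add; b_cnt; b_filt; b_stage; b_num; b_dbl; b_conv; b_convs; b_convss;
      b_last; b_lead; b_app; b_times K; b_solve].

(** * Encodings of the intermediate data *)

(** Vertices, sweeps, fuel and budget are small enough for unary notation; only the counts need
    binary. *)
Fixpoint un (m : nat) : tree := if m is m'.+1 then node leaf (un m') else leaf.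

Definition enc_pos (p : pos) : tree := node (un p.1) (un p.2).

(** With [Val true] as [leaf], [eor] computes [seqand]; the head of [Need p] is a node, which
    separates it from [Val false]. *)
Definition enc_res (x : res) : tree :=
  match x with Val true => leaf | Val false => node leaf leaf | Need p => node (enc_pos p) leaf end.

Definition enc_table : seq (pos * bool) -> tree :=
  enc_seq (fun x => node (enc_pos x.1) (enc_res (Val x.2))).

Definition enc_edge : seq nat -> tree := enc_seq un.
Definition enc_edges : seq (seq nat) -> tree := enc_seq enc_edge.

Ltac lsimp ::= cbn [enc_bool enc_res enc_pos].

Lemma enc_seq_cons (T : Type) (f : T -> tree) x s :
  enc_seq f (x :: s) = node (f x) (enc_seq f s).
Proof. by []. Qed.

Lemma enc_seq_nil (T : Type) (f : T -> tree) : enc_seq f [::] = leaf.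
Proof. by []. Qed.

Ltac lend := try solve [by [] | rewrite /=; lia].
Ltac lbody b := unfold calls; cbn [nth prog]; unfold b, eor, etrue; cbv beta zeta.

(** * Cost of the recursive evaluation *)

Section Specs.
Variable K : nat.
Notation runs_to := (calls (prog K)).

Lemma eq_spec u w : runs_to f_eq (node (un u) (un w)) (enc_bool (u == w)) (20 * u.+1).
Proof. by elim: u w => [|u IH] [|w]; lbody b_eq; cbn [un]; lgo; try lia. Qed.

Lemma le_spec u w : runs_to f_le (node (un u) (un w)) (enc_bool (u <= w)) (20 * u.+1).
Proof. by elim: u w => [|u IH] [|w]; lbody b_le; cbn [un]; lgo; try lia. Qed.

Ltac lspec ::= first [eapply eq_spec | eapply le_spec].

Lemma mem_spec u e : runs_to f_mem (node (un u) (enc_edge e)) (enc_bool (u \in e))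
  ((size e).+1 * (20 * u + 60)).
Proof.
elim: e => [|w e IH]; lbody b_mem; rewrite /enc_edge ?enc_seq_nil ?enc_seq_cons.
  by lgo; lend.
by rewrite in_cons; case uw: (u == w); lgo; lend.
Qed.

Lemma look_spec u s tb :
  runs_to f_look (node (node (un u) (un s)) (enc_table tb)) (enc_res (look tb (u, s)))
  ((size tb).+1 * (20 * u + 20 * s + 100)).
Proof.
elim: tb => [|[[u' s'] b] tb IH]; lbody b_look; rewrite /enc_table ?enc_seq_nil ?enc_seq_cons.
  by lgo; lend.
rewrite /enc_pos /= xpair_eqE.
by case uw: (u == u'); [case sw: (s == s')|]; lgo; lend.
Qed.

Lemma pos_spec u s w :
  runs_to f_pos (node (node (un u) (un s)) (un w)) (node (un w) (un (posn (u, s) w).2)) (20 * w + 60).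
Proof.
lbody b_pos; rewrite /posn /=.
by case wu: (w <= u); lgo; lend.
Qed.

Lemma neg_spec x : runs_to f_neg (enc_res x) (enc_res (neg x)) 20.
Proof. by case: x => [[]|[u s]]; lbody b_neg; rewrite /enc_res /enc_pos; lgo; lend. Qed.

Ltac lspec ::= first [eapply eq_spec | eapply le_spec | eapply mem_spec | eapply look_spec
  | eapply pos_spec | eapply neg_spec].

Variables (U k Delta : nat) (E : seq (seq nat)).
Hypothesis sizeE : size E <= U.
Hypothesis uniform : forall e : seq nat, e \in E -> size e <= k.
Hypothesis bounded : forall e : seq nat, e \in E -> all (leq^~ U) e.
Hypothesis degE : forall u : nat, count (fun e : seq nat => u \in e) E <= Delta.

Variable W : nat.
Hypothesis UW : U < W.

Let W_le : W <= W * W. Proof. by rewrite leq_pmulr // (leq_ltn_trans _ UW). Qed.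

Lemma posn_le p w : (posn p w).2 <= p.2.+1.
Proof. by rewrite /=; case: (w <= p.1). Qed.

Lemma look_time u s (tb : seq (pos * bool)) : u <= U -> s <= U -> size tb <= U ->
  (size tb).+1 * (20 * u + 20 * s + 100) <= 100 * (W * W).
Proof.
move=> uU sU tU; have -> : 100 * (W * W) = W * (100 * W) by lia.
by apply: leq_mul; lia.
Qed.

Lemma scan_spec u s e tb : u <= U -> s < U -> all (leq^~ U) e -> size tb <= U ->
  runs_to f_scan (node (node (un u) (un s)) (node (enc_edge e) (enc_table tb)))
    (enc_res (scan tb (u, s) e)) ((size e).+1 * (500 * (W * W))).
Proof.
move=> uU sU + tU; elim: e => [|w e IH]; lbody b_scan;
  rewrite /enc_edge ?enc_seq_nil ?enc_seq_cons; first by move=> _; lgo; lend.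
move=> /= /andP[wU /IH{}IH].
set X := node _ _; set LK := ECall f_look _.
have HL : leval (prog K) X LK (enc_res (look tb (posn (u, s) w))) (200 * (W * W)).
  rewrite /LK /X; lgo; [by []|].
  have := look_time wU (leq_trans (posn_le (u, s) w) sU) tU.
  by move: W_le; lia.
rewrite /scan /=; case hl: (look tb _) HL => [[]|q] HL /=; rewrite -/(scan tb (u, s) e).
all: by rewrite /X; lgo; [|move: W_le UW; rewrite /=; lia].
Qed.

Section Step.
Variables (tb : seq (pos * bool)) (f T : nat).
Hypothesis tbU : size tb <= U.
Hypothesis ev_IH : forall u s, u <= U -> s + f <= U ->
  runs_to f_ev (node (node (un u) (un s)) (node (enc_table tb) (node (enc_edges E) (un f))))
    (enc_res (ev f E tb (u, s))) T.

Let ctx := node (enc_table tb) (node (enc_edges E) (un f)).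

Lemma sub_spec u s e : u <= U -> s.+1 + f <= U -> all (leq^~ U) e ->
  runs_to f_sub (node (node (un u) (un s)) (node (enc_edge e) ctx))
    (enc_res (seqall (fun w => if w == u then Val true else ev f E tb (posn (u, s) w)) e))
    ((size e).+1 * (500 * (W * W) + 2 * T)).
Proof.
move=> uU sU; elim: e => [|w e IH]; lbody b_sub;
  rewrite /enc_edge ?enc_seq_nil ?enc_seq_cons; first by move=> _; lgo; lend.
move=> /= /andP[wU /IH{}IH].
case wu: (w == u); first by lgo; [by []|move: W_le UW; lia].
set X := node _ _; set LK := ECall f_ev _.
have HL : leval (prog K) X LK (enc_res (ev f E tb (posn (u, s) w))) (100 * W + T).
  rewrite /LK /X; eapply leval_sub; [lrun| |]; rewrite ?wU //.
  - by apply: leq_trans sU; rewrite leq_add2r; exact: posn_le.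
  - by move: UW; lia.
rewrite /=; case hl: (ev _ _ _ _) HL => [[]|q] HL /=.
all: rewrite /X; lgo; [by []|move: W_le UW; lia].
Qed.

Ltac lspec ::= first [eapply eq_spec | eapply le_spec | eapply mem_spec | eapply look_spec
  | eapply pos_spec | eapply neg_spec | eapply scan_spec | eapply sub_spec].

Let step u s e := if u \in e then
  neg (seqand (scan tb (u, s) e)
    (seqall (fun w => if w == u then Val true else ev f E tb (posn (u, s) w)) e))
  else Val true.

Let H1 := k.+1 * (W * W).
Let H2 := k.+1 * (2000 * (W * W) + 2 * T).

(** Only edges through [u] are charged for recursive calls. Their number is at most [Delta];
    branching over all edges to logarithmic depth would not be polynomial. *)
Lemma edge_spec u s e : u <= U -> s.+1 + f <= U -> all (leq^~ U) e -> size e <= k ->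
  runs_to f_edge (node (node (un u) (un s)) (node (enc_edge e) ctx))
    (enc_res (step u s e)) (100 * H1 + (u \in e) * H2).
Proof.
move=> uU sU eU ek; lbody b_edge.
have sU' : s < U by apply: leq_trans sU; rewrite leq_addr.
have le_mem : (size e).+1 * (20 * u + 60) <= 60 * H1.
  rewrite /H1 mulnCA; apply: leq_mul => //; move: W_le UW; lia.
have H1_ge : W <= H1 by rewrite /H1; apply: leq_trans W_le _; rewrite leq_pmull.
rewrite /step; case ue: (u \in e); last by lgo; [|move: UW; lia].
have le1 : (size e).+1 * (500 * (W * W)) <= k.+1 * (500 * (W * W)) by apply: leq_mul.
have le2 : (size e).+1 * (500 * (W * W) + 2 * T) <= k.+1 * (500 * (W * W) + 2 * T).
  by apply: leq_mul.
set X := node _ _; set SC := ECall f_scan _.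
have HS : leval (prog K) X SC (enc_res (scan tb (u, s) e)) (k.+1 * (500 * (W * W)) + 20).
  by rewrite /SC /X; lgo; rewrite //; lia.
case hs: (scan _ _ _) HS => [[]|q] HS.
all: rewrite /X; eapply leval_sub;
  [lrun; try (by []); solve [eapply (neg_spec (seqall _ _)) | eapply (neg_spec (Val _))
                            | eapply (neg_spec (Need _))]| |]; rewrite //.
all: rewrite /H1 /H2 in le_mem H1_ge *; move: W_le UW; lia.
Qed.

Lemma edges_spec u s El : u <= U -> s.+1 + f <= U ->
  (forall e, e \in El -> all (leq^~ U) e) -> (forall e, e \in El -> size e <= k) ->
  runs_to f_edges (node (node (un u) (un s)) (node (enc_edges El) ctx))
    (enc_res (seqall (step u s) El))
    ((size El).+1 * (300 * H1) + count (fun e : seq nat => u \in e) El * (2 * H2)).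
Proof.
move=> uU sU; have H1_ge : W <= H1 by rewrite /H1; apply: leq_trans W_le _; rewrite leq_pmull.
elim: El => [|e El IH] hU hk; lbody b_edges;
  rewrite /enc_edges ?enc_seq_nil ?enc_seq_cons; first by lgo; [|move: UW; rewrite /=; lia].
have {}IH := IH (fun e' h => hU e' (mem_behead (s := e :: El) h))
               (fun e' h => hk e' (mem_behead (s := e :: El) h)).
have he := @edge_spec u s e uU sU (hU e (mem_head _ _)) (hk e (mem_head _ _)).
set X := node _ _; set EC := ECall f_edge _.
have HE : leval (prog K) X EC (enc_res (step u s e)) (100 * H1 + (u \in e) * H2 + 20).
  by rewrite /EC /X; lgo; rewrite //; lia.
have -> : seqall (step u s) (e :: El) = seqand (step u s e) (seqall (step u s) El) by [].
have -> : (size (e :: El)).+1 * (300 * H1) +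
   count (fun e0 : seq nat => u \in e0) (e :: El) * (2 * H2) = 300 * H1 + 2 * ((u \in e) * H2) +
  ((size El).+1 * (300 * H1) + count (fun e : seq nat => u \in e) El * (2 * H2)).
  by rewrite /=; ring.
move: HE IH; move: (_ + count _ _ * _) => c HE IH.
case hs: (step u s e) HE => [[]|q] HE; rewrite /X; lgo; rewrite //; move: UW; lia.
Qed.

End Step.

(** The two factors [2] pay for [eor], which may evaluate a call twice: once in the loop over edges,
    once in the loop over vertices. *)
Fixpoint ev_time (f : nat) : nat :=
  if f is f'.+1 then
    W * (800 * (k.+1 * (W * W))) + Delta * (2 * (k.+1 * (2000 * (W * W) + 2 * ev_time f')))
  else W * (800 * (k.+1 * (W * W))).

(** A recursive call consumes one unit of fuel and raises the sweep index by at most one, so [s + f]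
    never grows. *)
Lemma ev_spec tb f u s : size tb <= U -> u <= U -> s + f <= U ->
  runs_to f_ev (node (node (un u) (un s)) (node (enc_table tb) (node (enc_edges E) (un f))))
    (enc_res (ev f E tb (u, s))) (ev_time f).
Proof.
move=> tU; have W0 : 0 < W by apply: leq_ltn_trans UW.
have W2 : W * W <= W * (k.+1 * (W * W)).
  by rewrite leq_pmul2l //; apply: leq_trans W_le _; rewrite leq_pmull.
elim: f u s => [|f IH] u s uU sU; lbody b_ev.
all: set X := node _ _; set LK := ECall f_look _.
all: have HL : leval (prog K) X LK (enc_res (look tb (u, s))) (100 * (W * W) + 20)
  by rewrite /LK /X; lgo; rewrite //;
     have := look_time uU (leq_trans (leq_addr _ _) sU) tU; lia.
  rewrite /=; case hs: (look _ _) HL => [[]|q] HL; rewrite /X; cbn [un]; lgo; rewrite //;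
  move: W_le UW W2; lia.
rewrite [enc_res _]/=; rewrite addnS -addSn in sU.
have := @edges_spec tb f (ev_time f) tU IH u s E uU sU bounded uniform.
set c := (size E).+1 * _; set c' := count _ _ * _ => HE.
have hc : c <= W * (300 * (k.+1 * (W * W))) by apply: leq_mul => //; exact: leq_ltn_trans UW.
have hc' : c' <= Delta * (2 * (k.+1 * (2000 * (W * W) + 2 * ev_time f))).
  by apply: leq_mul => //; exact: degE.
rewrite [ev_time _]/=; set c'' := Delta * _ in hc' *.
case hs: (look _ _) HL => [[]|q] HL; rewrite /X; cbn [un]; lgo; rewrite //;
  move: W_le UW W2; lia.
Qed.

End Specs.

(** * Binary arithmetic *)

Lemma bit_length_le b x : (bit_length x <= b) = (x < 2 ^ b).
Proof.
apply/idP/idP => [h|h]; last exact: up_log_min.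
by apply: leq_trans (up_logP x.+1 (isT : 1 < 2)) _; rewrite leq_exp2l.
Qed.

Lemma bit_length_half x : 0 < x -> bit_length x = (bit_length x./2).+1.
Proof.
move=> x0.
have h b : (bit_length x <= b.+1) = (bit_length x./2 <= b).
  by rewrite !bit_length_le expnS; lia.
apply/eqP; rewrite eqn_leq h leqnn /=.
have := bit_length_le 0 x; have := h (bit_length x).-1; lia.
Qed.

Lemma bitsS l x : bits l.+1 x = odd x :: bits l x./2.
Proof.
rewrite /bits /= expn0 divn1 -[1]addn0 iotaDl -map_comp; congr (_ :: _).
by apply: eq_map => i /=; rewrite add1n expnS divnMA divn2.
Qed.

Lemma bits_rcons l x : bits l.+1 x = rcons (bits l x) (odd (x %/ 2 ^ l)).
Proof. by rewrite /bits -[l.+1]addn1 iotaD map_cat cats1. Qed.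

Lemma size_bits l x : size (bits l x) = l.
Proof. by rewrite size_map size_iota. Qed.

Lemma enc_nat_pos x : 0 < x -> enc_nat x = node (enc_bool (odd x)) (enc_nat x./2).
Proof. by move=> x0; rewrite /enc_nat bit_length_half // bitsS. Qed.

Lemma enc_nat0 : enc_nat 0 = leaf.
Proof. by []. Qed.

Lemma enc_nat_double x : 0 < x -> enc_nat (2 * x) = node leaf (enc_nat x).
Proof. by move=> x0; rewrite enc_nat_pos ?muln_gt0 // mul2n odd_double doubleK. Qed.

Lemma enc_nat_doubleS x : enc_nat (2 * x).+1 = node (node leaf leaf) (enc_nat x).
Proof. by rewrite enc_nat_pos // mul2n /= odd_double uphalf_double. Qed.

Section Arith.
Variable K : nat.
Notation runs_to := (calls (prog K)).

Lemma shift_spec b x : 0 < x ->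
  runs_to f_shift (node (un b) (enc_nat x)) (enc_nat (x * 2 ^ b)) (20 * b.+1).
Proof.
move=> x0; elim: b => [|b IH]; lbody b_shift; cbn [un]; first by rewrite expn0 muln1; lgo; lend.
lgo; last by lia.
by rewrite expnS mulnCA enc_nat_double // muln_gt0 x0 expn_gt0.
Qed.

Lemma inc_spec b y : y < 2 ^ b -> runs_to f_inc (enc_nat y) (enc_nat y.+1) (20 * b.+1).
Proof.
elim: b y => [|b IH] y; lbody b_inc.
  by rewrite expn0 ltnS leqn0 => /eqP->; rewrite enc_nat0; lgo; lend.
case: (posnP y) => [->|y0] yb; first by rewrite enc_nat0; lgo; lend.
have hb : y./2 < 2 ^ b by rewrite expnS in yb; lia.
rewrite enc_nat_pos //; have := odd_double_half y; case oy: (odd y) => <-.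
  rewrite add1n /= uphalf_double; have {}IH := IH _ hb.
  lgo; last by lia.
  by rewrite -enc_nat_double // mul2n doubleS.
by rewrite add0n doubleK; lgo; [rewrite -mul2n enc_nat_doubleS|lia].
Qed.

Lemma add_spec b c x y : x < 2 ^ b -> y < 2 ^ b ->
  runs_to f_add (node (enc_bool c) (node (enc_nat x) (enc_nat y))) (enc_nat (c + x + y))
    (100 * b.+1).
Proof.
elim: b c x y => [|b IH] c x y.
  rewrite expn0 !ltnS !leqn0 => /eqP-> /eqP->; lbody b_add; rewrite enc_nat0.
  have hi := @inc_spec 0 0 isT; rewrite enc_nat0 in hi.
  by case: c; lgo; lend.
move=> xb yb; lbody b_add.
case: (posnP x) => [->|x0]; rewrite ?enc_nat0 ?addn0.
  have hi := inc_spec yb.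
  by case: c; lgo; rewrite ?add1n ?add0n //; lia.
case: (posnP y) => [->|y0]; rewrite ?enc_nat0 ?addn0.
  have hi := inc_spec xb; rewrite enc_nat_pos // in hi *.
  by case: c; lgo; rewrite ?add1n ?add0n -?enc_nat_pos //; lia.
have xb' : x./2 < 2 ^ b by rewrite expnS in xb; lia.
have yb' : y./2 < 2 ^ b by rewrite expnS in yb; lia.
have I0 := IH false _ _ xb' yb'; have I1 := IH true _ _ xb' yb'; cbn [enc_bool] in I0, I1.
rewrite (enc_nat_pos x0) (enc_nat_pos y0).
have even z : 0 < z -> node leaf (enc_nat z) = enc_nat (2 * z).
  by move=> ?; rewrite enc_nat_double.
have odd' z : node (node leaf leaf) (enc_nat z) = enc_nat (2 * z).+1 by rewrite enc_nat_doubleS.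
rewrite -[in c + x](odd_double_half x) -[in _ + y](odd_double_half y) -!mul2n in x0 y0 *.
rewrite -{1}(odd_double_half x) -mul2n in x0; rewrite -{1}(odd_double_half y) -mul2n in y0.
clear IH xb yb xb' yb'; move: (x./2) (y./2) (odd x) (odd y) x0 y0 I0 I1 => x' y' ox oy x0 y0 I0 I1.
case: c; case: ox x0; case: oy y0 => y0 x0; cbn [enc_bool].
all: lgo; [|by lia].
all: rewrite ?odd' ?even; [congr enc_nat; lia|lia..].
Qed.

End Arith.

Lemma cntE fuel E v b tb : cnt fuel E v b tb = match ev fuel E tb (v, 0) with
  | Val false => 2 ^ b
  | Val true => 0
  | Need p => if b is b'.+1 then
      cnt fuel E v b' ((p, false) :: tb) + cnt fuel E v b' ((p, true) :: tb) else 0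
  end.
Proof. by case: b. Qed.

Lemma cnt_le fuel E v b tb : cnt fuel E v b tb <= 2 ^ b.
Proof.
elim: b tb => [|b IH] tb; rewrite cntE; case: (ev _ _ _ _) => [[]|p]; rewrite ?expn_gt0 ?leqnn //.
by rewrite expnS mul2n -addnn leq_add.
Qed.

Lemma enc_seq_map (T T' : Type) (h : T -> T') (f : T' -> tree) s :
  enc_seq f (map h s) = enc_seq (f \o h) s.
Proof. by elim: s => //= x s <-. Qed.

Lemma eq_enc_seq (T : Type) (f g : T -> tree) s : f =1 g -> enc_seq f s = enc_seq g s.
Proof. by move=> h; elim: s => // x s IH; rewrite !enc_seq_cons h IH. Qed.

(** * Cost of the decision tree, the stages and the input conversion *)

Section Specs.
Variable K : nat.
Notation runs_to := (calls (prog K)).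

Ltac lspec ::= first [eapply eq_spec | eapply le_spec | eapply mem_spec | eapply shift_spec].

Lemma num_spec B (vs : seq nat) :
  runs_to f_num (node (enc_edge vs) (un B)) (enc_nat (2 ^ (B * size vs)))
    ((size vs).+1 * (20 * B.+1 + 50)).
Proof.
elim: vs => [|v vs IH]; lbody b_num; rewrite /enc_edge ?enc_seq_nil ?enc_seq_cons.
  by rewrite muln0; lgo; lend.
have hs := @shift_spec K B (2 ^ (B * size vs)) ltac:(by rewrite expn_gt0).
by lgo; [rewrite /= -expnD mulnS addnC|rewrite /=; lia].
Qed.

Section Counting.
Variables (U k Delta W : nat).
Hypothesis UW : U < W.

Record small (E : seq (seq nat)) : Prop := Small {
  small_size : size E <= U;
  small_uniform : forall e : seq nat, e \in E -> size e <= k;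
  small_bounded : forall e : seq nat, e \in E -> all (leq^~ U) e;
  small_degree : forall u : nat, count (fun e : seq nat => u \in e) E <= Delta }.

Fixpoint cnt_time (C b : nat) : nat := if b is b'.+1 then C + 2 * cnt_time C b' else C.

(** The accumulated denominator is handed down the tree, shifted at the leaves and added at the
    inner nodes, which avoids multiplication. [Y] bounds the length of the numbers that occur, and
    [4 * ev_time] pays for the repeated evaluations of the same result at a node. *)
Lemma cnt_spec E v fuel den Y b tb : small E -> v <= U -> fuel <= U -> 0 < den ->
  size tb + b <= U -> den * 2 ^ b < 2 ^ Y ->
  runs_to f_cnt (node (un b) (node (enc_table tb) (node (un v) (node (enc_edges E)
      (node (un fuel) (enc_nat den))))))
    (enc_nat (den * cnt fuel E v b tb))
    (cnt_time (4 * ev_time k Delta W fuel + 20 * W + 100 * Y.+1 + 300) b).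
Proof.
move=> [sE uE bE dE] vU fU d0; set C := 4 * _ + _ + _ + _.
elim: b tb => [|b IH] tb tU dY.
all: have hev := @ev_spec K U k Delta E sE uE bE dE W UW tb fuel v 0
   (leq_trans (leq_addr _ _) tU) vU fU; cbn [un] in hev.
all: lbody b_cnt; set ctx := ETl (ETl EArg); set r := ECall f_ev _.
all: set X := node _ _.
all: have HR : leval (prog K) X r (enc_res (ev fuel E tb (v, 0))) (ev_time k Delta W fuel + 40)
  by rewrite /r /ctx /X; lgo; rewrite //; lia.
  rewrite cntE; case: (ev fuel E tb (v, 0)) HR => [[]|q] HR; rewrite /X /ctx;
    cbn [un].
  - by lgo; rewrite ?muln0 //= /C; lia.
  - have hs := @shift_spec K 0 den d0; cbn [un] in hs.
    by lgo; rewrite //= /C; lia.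
  - by lgo; rewrite ?muln0 //= /C; lia.
have dY' : den * 2 ^ b < 2 ^ Y by apply: leq_ltn_trans dY; rewrite leq_mul2l leq_exp2l ?leqnSn ?orbT.
have cY c q : den * cnt fuel E v b ((q, c) :: tb) < 2 ^ Y.
  by apply: leq_ltn_trans dY'; rewrite leq_mul2l cnt_le orbT.
have {}IH c q : runs_to f_cnt (node (un b) (node (enc_table ((q, c) :: tb)) (node (un v)
    (node (enc_edges E) (node (un fuel) (enc_nat den))))))
    (enc_nat (den * cnt fuel E v b ((q, c) :: tb))) (cnt_time C b).
  by apply: IH => //; rewrite /= addSnnS.
have C0 : C <= cnt_time C b by case: (b) => //= b'; rewrite leq_addr.
have bW : b < W by apply: leq_ltn_trans UW; apply: leq_trans tU; rewrite addnS; lia.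
rewrite cntE; case: (ev fuel E tb (v, 0)) HR => [[]|q] HR; rewrite /X /ctx; cbn [un].
- by clear IH; lgo; rewrite ?muln0 //= /C; lia.
- clear IH; have hs := @shift_spec K b.+1 den d0; cbn [un] in hs.
  by lgo; rewrite //= /C; lia.
- have I0 := IH false q; have I1 := IH true q; rewrite /enc_table !enc_seq_cons in I0 I1.
  cbn [enc_res fst snd] in I0, I1.
  have hadd := @add_spec K Y false _ _ (cY false q) (cY true q); cbn [enc_bool] in hadd.
  clear IH; cbn [enc_res] in HR.
  by lgo; [rewrite mulnDr|
    rewrite -[cnt_time C b.+1]/(C + 2 * cnt_time C b); move: (erefl C); rewrite {2}/C; lia].
Qed.

Lemma small_filter E P : small E -> small [seq e <- E | P e].
Proof.
case=> h1 h2 h3 h4; split=> [|e|e|u]; rewrite ?mem_filter; try (by move=> /andP[_ eE]; auto).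
  by apply: leq_trans h1; rewrite size_filter count_size.
by apply: leq_trans (h4 u); rewrite count_filter; apply: sub_count => e /= /andP[].
Qed.

Lemma filt_spec v E : v <= U -> (forall e : seq nat, e \in E -> size e <= k) ->
  runs_to f_filt (node (un v) (enc_edges E)) (enc_edges [seq e <- E | v \notin e])
    ((size E).+1 * (k.+1 * (60 * W) + 60)).
Proof.
move=> vU; elim: E => [|e E IH] hk; lbody b_filt; rewrite /enc_edges ?enc_seq_nil ?enc_seq_cons.
  by lgo; lend.
have {}IH := IH (fun e' h => hk e' (mem_behead (s := e :: E) h)).
have le1 : (size e).+1 * (20 * v + 60) <= k.+1 * (60 * W).
  by apply: leq_mul; [rewrite ltnS hk ?mem_head|lia].
rewrite /= -/(enc_edge e); set c := k.+1 * _ in le1 IH *.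
case ve: (v \in e) => /=; lgo; rewrite ?enc_seq_cons //;
  move: le1; set y := (size e).+1 * _; set z := size E; clearbody c y z; lia.
Qed.

Lemma convs_spec (s : seq nat) : all (leq^~ U) s ->
  (forall x, runs_to f_conv (enc_nat x) (un x) (100 * x.+1)) ->
  runs_to f_convs (enc_seq enc_nat s) (enc_edge s) ((size s).+1 * (100 * W + 50)).
Proof.
move=> + hc; elim: s => [|x s IH]; lbody b_convs; rewrite ?enc_seq_nil ?enc_seq_cons.
  by move=> _; lgo; lend.
by move=> /= /andP[xU /IH{}IH]; lgo; [|lia].
Qed.

Lemma convss_spec (E : seq (seq nat)) : (forall e : seq nat, e \in E -> all (leq^~ U) e) ->
  (forall e : seq nat, e \in E -> size e <= k) ->
  (forall x, runs_to f_conv (enc_nat x) (un x) (100 * x.+1)) ->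
  runs_to f_convss (enc_seq (enc_seq enc_nat) E) (enc_edges E)
    ((size E).+1 * (k.+1 * (100 * W + 50) + 50)).
Proof.
move=> + + hc; elim: E => [|e E IH] hU hk; lbody b_convss; rewrite ?enc_seq_nil ?enc_seq_cons.
  by lgo; lend.
have {}IH := IH (fun e' h => hU e' (mem_behead (s := e :: E) h))
   (fun e' h => hk e' (mem_behead (s := e :: E) h)).
have he := convs_spec (hU e (mem_head _ _)) hc.
have le1 : (size e).+1 * (100 * W + 50) <= k.+1 * (100 * W + 50).
  by apply: leq_mul => //; rewrite ltnS hk ?mem_head.
move: (k.+1 * _) ((size e).+1 * _) le1 he IH => c c' le1 he IH; clear hc.
by lgo; [|rewrite /=; lia].
Qed.

Variables (B Y : nat).
Hypotheses (B0 : 0 < B) (BU : B < U).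

Definition stage_step_time : nat :=
  W * (k.+1 * (60 * W) + 60) +
  cnt_time (4 * ev_time k Delta W B.+1 + 20 * W + 100 * Y.+1 + 300) B + 100.

Lemma stage_spec vs E den : small E -> all (leq^~ U) vs -> 0 < den ->
  den * 2 ^ (B * size vs) < 2 ^ Y ->
  runs_to f_stage (node (enc_edge vs) (node (enc_edges E) (node (enc_nat den) (un B))))
    (enc_nat (stage B vs E den)) ((size vs).+1 * stage_step_time).
Proof.
elim: vs E den => [|v vs IH] E den hE; lbody b_stage;
  rewrite /enc_edge ?enc_seq_nil ?enc_seq_cons.
  by move=> _ _ _; lgo; rewrite //= /stage_step_time; lia.
move=> /= /andP[vU vsU] d0 dY.
have dB : den * 2 ^ B < 2 ^ Y.
  by apply: leq_ltn_trans dY; rewrite leq_mul2l leq_exp2l ?leq_pmulr ?orbT.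
have c0 := @cnt_gt0 B.+1 E v B B0.
have {}IH := IH _ (den * cnt B.+1 E v B [::]) (small_filter (fun e => v \notin e) hE) vsU.
have {}IH := IH _ _.
have hc := @cnt_spec E v B.+1 den Y B [::] hE vU BU d0 (ltnW BU) dB; cbn [un] in hc.
have hf := @filt_spec v E vU (small_uniform hE).
rewrite /enc_table enc_seq_nil in hc.
have {}IH : runs_to f_stage (node (enc_edge vs) (node (enc_edges [seq e <- E | v \notin e])
      (node (enc_nat (den * cnt B.+1 E v B [::])) (un B))))
    (enc_nat (stage B vs [seq e <- E | v \notin e] (den * cnt B.+1 E v B [::])))
    ((size vs).+1 * stage_step_time).
  apply: IH; first by rewrite muln_gt0 d0.
  apply: leq_ltn_trans dY; rewrite mulnS expnD mulnA leq_mul2r leq_mul2l cnt_le !orbT //.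
have lf : (size E).+1 * (k.+1 * (60 * W) + 60) <= W * (k.+1 * (60 * W) + 60).
  by apply: leq_mul => //; apply: leq_ltn_trans UW; exact: small_size hE.
set st := stage_step_time in IH *.
have hst : W * (k.+1 * (60 * W) + 60) +
  cnt_time (4 * ev_time k Delta W B.+1 + 20 * W + 100 * Y.+1 + 300) B + 100 <= st by [].
lgo; rewrite //.
move: lf hst; set c1 := _ * (_ + 60); set c2 := W * (_ + 60); set c3 := cnt_time _ _; lia.
Qed.

End Counting.

Lemma dbl_spec x : runs_to f_dbl (un x) (un x.*2) (20 * x.+1).
Proof. by elim: x => [|x IH]; lbody b_dbl; cbn [un double]; lgo; lend. Qed.

Lemma conv_spec x : runs_to f_conv (enc_nat x) (un x) (100 * x.+1).
Proof.
have [b] := ubnP x; elim: b x => // b IH x xb; lbody b_conv.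
case: (posnP x) => [->|x0]; first by rewrite enc_nat0; lgo; lend.
have {}IH : runs_to f_conv (enc_nat x./2) (un x./2) (100 * (x./2).+1) by apply: IH; lia.
have hd := dbl_spec x./2.
have hx := odd_double_half x; rewrite (enc_nat_pos x0).
by case ox: (odd x) hx => hx; lgo; (try lia); rewrite -[in RHS]hx.
Qed.

Lemma list_last_spec (T : Type) (f : T -> tree) x s :
  runs_to f_last (enc_seq f (x :: s)) (f (last x s)) (20 * (size s).+1).
Proof.
elim: s x => [|y s IH] x; lbody b_last; rewrite !enc_seq_cons ?enc_seq_nil.
  by lgo; lend.
have {}IH := IH y; rewrite enc_seq_cons in IH.
by lgo; lend.
Qed.

Lemma app_spec (T : Type) (f : T -> tree) l y :
  runs_to f_app (node (enc_seq f l) (un y)) (un (size l + y)) (20 * (size l).+1).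
Proof.
elim: l => [|x l IH]; lbody b_app; rewrite ?enc_seq_cons ?enc_seq_nil; first by lgo; lend.
by lgo; lend.
Qed.

Lemma un_enc m : un m = enc_seq (fun _ : unit => leaf) (nseq m tt).
Proof. by elim: m => //= m ->. Qed.

Lemma times_spec c m :
  leval (prog K) (un m) (b_times c) (un (c * m)) (c * (20 * m.+1 + 20) + 1).
Proof.
elim: c => [|c IH]; first exact: leval_nil.
have ha := @app_spec _ (fun _ : unit => leaf) (nseq m tt) (c * m).
rewrite -un_enc size_nseq in ha.
rewrite /b_times iterS -/(b_times c); lgo; lend.
Qed.

(** The digits come most significant first and the scan stops at the first [1] of [a], so the cost
    depends on [j] alone and not on the length of [a] and [b]. *)
Lemma lead_spec a b l : 0 < a < 2 ^ l ->
  exists j, [/\ runs_to f_lead (enc_seq (fun d => node (enc_bool d.1) (enc_bool d.2))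
                   (rev (zip (bits l a) (bits l b)))) (un j) (20 * j.+1),
                2 ^ l <= a * 2 ^ j.+1 & a * 2 ^ j < 2 ^ l].
Proof.
elim: l => [|l IH] /andP[a0 al]; first by rewrite expn0 in al; lia.
rewrite !bits_rcons zip_rcons ?size_bits // rev_rcons enc_seq_cons.
have := ltn_pmod a (expn_gt0 2 l : 0 < 2 ^ l) ; have := divn_eq a (2 ^ l) => da ma.
have [la|la] := leqP (2 ^ l) a.
  have ha : odd (a %/ 2 ^ l) = true.
    suff -> : a %/ 2 ^ l = 1 by [].
    by apply/eqP; rewrite eqn_leq -ltnS ltn_divLR ?expn_gt0 // -expnS al divn_gt0 ?expn_gt0.
  exists 0; split; [|by rewrite expnS expn1; lia|by rewrite expn0 muln1].
  by lbody b_lead; rewrite /= ha; lgo; lend.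
case: IH => [|j [hj h1 h2]]; first by rewrite a0.
exists j.+1; split; last 2 first.
- by rewrite [2 ^ j.+2]expnS mulnCA [2 ^ l.+1]expnS leq_mul2l.
- by rewrite !expnS mulnCA ltn_mul2l.
have ha : odd (a %/ 2 ^ l) = false by rewrite divn_small.
by lbody b_lead; rewrite /= ha; lgo; lend.
Qed.

End Specs.

(** * The whole program and its running time *)

Section Main.
Variables (n k Delta K m : nat).

Definition range_bound : nat := n * Delta.+1 + K * m + 2.

Definition solve_time : nat :=
  let W := range_bound.+1 in
  n.+1 * (20 * (K * m).+1 + 50) +
  n.+1 * stage_step_time k Delta W (K * m) (K * m * n).+1 + 50.

Definition main_time : nat :=
  let W := range_bound.+1 in
  60 * n.+1 + 40 * m.+1 + K * (20 * m.+1 + 20) + n.+1 * (100 * W + 50) +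
  (n * Delta).+1 * (k.+1 * (100 * W + 50) + 50) + solve_time + 200.

(** Double counting of incidences; as [k > 0], each edge contributes at least one. *)
Lemma regular_card E : 0 < k -> regular n k Delta E -> size E <= n * Delta.
Proof.
move=> k0 hE; apply: leq_trans (_ : \sum_(u < n) count (fun e : seq nat => val u \in e) E <= _).
  case: hE => _ hs hl _; elim: E hs hl => [|e E IH] hs hl; first by rewrite leq0n.
  have {}IH := IH (fun e' h => hs e' (mem_behead (s := e :: E) h))
               (fun e' h => hl e' (mem_behead (s := e :: E) h)).
  rewrite /= big_split -add1n leq_add //=.
  case: e hs hl {IH} => [|w e] hs hl; first by move: k0; rewrite -(hs [::]) ?mem_head.
  have /andP[wn _] := hl _ (mem_head _ _).
  by rewrite (bigD1 (Ordinal wn)) //= mem_head.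
apply: leq_trans (_ : \sum_(u < n) Delta <= _); last by rewrite sum_nat_const card_ord.
by apply: leq_sum => u _; exact: regular_degree hE _.
Qed.

Lemma solve_spec E : 0 < n -> 0 < k -> 0 < K * m -> regular n k Delta E ->
  calls (prog K) f_solve (node (un (K * m)) (node (enc_edge (iota 0 n)) (enc_edges E)))
    (node (enc_nat (2 ^ (K * m * n))) (enc_nat (stage (K * m) (iota 0 n) E 1))) solve_time.
Proof.
move=> n0 k0 B0 hE; set B := K * m.
have nU : n <= range_bound by rewrite /range_bound; lia.
have sE : small range_bound k Delta E.
  split=> [|e /(regular_size hE)->//|e /(regular_lt hE)|u]; last exact: regular_degree hE _.
    by apply: leq_trans (regular_card k0 hE) _; rewrite /range_bound; lia.
  by apply: sub_all => w /= /ltnW/leq_trans; apply.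
have vsU : all (leq^~ range_bound) (iota 0 n).
  by apply/allP => i; rewrite mem_iota => /andP[_ /ltnW/leq_trans]; apply.
have BU : B < range_bound by rewrite /range_bound /B; lia.
have hnum := @num_spec K B (iota 0 n).
have hst := @stage_spec K range_bound k Delta range_bound.+1 (ltnSn _) B (B * n).+1 B0 BU
   (iota 0 n) E 1 sE vsU isT.
rewrite !size_iota mul1n ltn_exp2l // in hnum hst; have {}hst := hst (ltnSn _).
have e1 : enc_nat 1 = node (node leaf leaf) leaf by [].
rewrite e1 in hst.
lbody b_solve; lgo; first by [].
rewrite /solve_time -/B; move: (_ * stage_step_time _ _ _ _ _) (_ * (_ + 50)) => c1 c2; lia.
Qed.

End Main.

Lemma exp_bit_length x : 0 < x -> 2 ^ bit_length x <= 2 * x.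
Proof.
move=> x0; rewrite bit_length_half // expnS leq_mul2l /= leqNgt -bit_length_le.
by rewrite bit_length_half // ltnn.
Qed.

(** The scale [m] is read off the input: [bit_length n.-1] is the length of the code of the last
    vertex and [j] the number of leading zeros of [a]. Concatenating [K] copies yields the
    budget. *)
Lemma main_spec n k Delta K a b E : 0 < n -> 0 < k -> 0 < K -> regular n k Delta E -> 0 < a < b ->
  exists j, let m := bit_length n.-1 + j + 5 in
  [/\ leval (prog K) (node (node (enc_seq enc_nat (iota 0 n)) (enc_seq (enc_seq enc_nat) E))
                           (enc_frac a b)) (ECall 0 EArg)
        (node (enc_nat (2 ^ (K * m * n))) (enc_nat (stage (K * m) (iota 0 n) E 1)))
        (main_time n k Delta K m),
      b <= a * 2 ^ j.+1 & a * 2 ^ j <= 2 * b].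
Proof.
move=> n0 k0 K0 hE /andP[a0 ab]; set l := bit_length b.
have bl : b < 2 ^ l by rewrite -bit_length_le.
have lb : 2 ^ l <= 2 * b by apply: exp_bit_length; exact: ltn_trans ab.
have [|j [hlead h1 h2]] := @lead_spec K a b l; first by rewrite a0 (ltn_trans ab).
exists j; move=> m; split; last 2 first.
- by apply: leq_trans (ltnW bl) h1.
- by apply: leq_trans (ltnW h2) lb.
have B0 : 0 < K * m by rewrite muln_gt0 K0 /m addnS.
have hsolve := @solve_spec n k Delta K m E n0 k0 B0 hE.
have hlast : calls (prog K) f_last (enc_seq enc_nat (iota 0 n)) (enc_nat n.-1) (20 * n).
  have := @list_last_spec K _ enc_nat 0 (iota 1 n.-1); rewrite size_iota prednK //.
  have -> : last 0 (iota 1 n.-1) = n.-1.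
    have last_iota i x : last x (iota x.+1 i) = x + i.
      by elim: i x => [|i IH] x /=; rewrite ?addn0 // IH addSnnS.
    by rewrite last_iota.
  by have -> : 0 :: iota 1 n.-1 = iota 0 n by case: (n) n0.
have happ := @app_spec K _ enc_bool (bits (bit_length n.-1) n.-1) j.
rewrite -/(enc_nat n.-1) size_bits in happ.
have nU : n <= range_bound n Delta K m by rewrite /range_bound; lia.
have vsU : all (leq^~ (range_bound n Delta K m)) (iota 0 n).
  by apply/allP => i; rewrite mem_iota => /andP[_ /ltnW/leq_trans]; apply.
have hvs := @convs_spec K _ _ (ltnSn (range_bound n Delta K m)) _ vsU (conv_spec K).
have hEs : calls (prog K) f_convss (enc_seq (enc_seq enc_nat) E) (enc_edges E)
    ((size E).+1 * (k.+1 * (100 * (range_bound n Delta K m).+1 + 50) + 50)).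
  apply: (convss_spec (ltnSn _) _ _ (conv_spec K)) => [e /(regular_lt hE)|e /(regular_size hE)->//].
  by apply: sub_all => w /= /ltnW/leq_trans; apply.
have ht := times_spec K K m.
have {}ht : calls (prog K) f_times (un m) (un (K * m)) (K * (20 * m.+1 + 20) + 1) by [].
have mE : un m = node leaf (node leaf (node leaf (node leaf (node leaf
   (un (bit_length n.-1 + j)))))) by rewrite /m !addnS addn0.
rewrite mE in ht; rewrite size_iota in hvs.
have lE : (size E).+1 * (k.+1 * (100 * (range_bound n Delta K m).+1 + 50) + 50) <=
   (n * Delta).+1 * (k.+1 * (100 * (range_bound n Delta K m).+1 + 50) + 50).
  by apply: leq_mul => //; rewrite ltnS (regular_card k0 hE).
have -> : enc_frac a b = enc_seq (fun d => node (enc_bool d.1) (enc_bool d.2))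
  (rev (zip (bits l a) (bits l b))) by [].
set frac := enc_seq _ (rev _) in hlead *.
have hmain : calls (prog K) 0 (node (node (enc_seq enc_nat (iota 0 n))
   (enc_seq (enc_seq enc_nat) E)) frac)
  (node (enc_nat (2 ^ (K * m * n))) (enc_nat (stage (K * m) (iota 0 n) E 1)))
  (main_time n k Delta K m - 10).
  lbody b_main; rewrite [iter 5 _ _]/=; lgo; first by [].
  rewrite /main_time; move: lE.
  set c1 := (size E).+1 * _; set c2 := (n * Delta).+1 * _; set c3 := solve_time _ _ _ _ _.
  set c4 := n.+1 * _; set c5 := K * _.
  have : bit_length n.-1 + j + 5 = m by [].
  move: (bit_length n.-1) => bl'; clearbody c1 c2 c3 c4 c5 m; lia.
eapply leval_sub; [eapply leval_call; [exact: leval_arg|exact: hmain]|by []|].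
rewrite /main_time; lia.
Qed.

Section Polynomial.

(** Growth is measured in [2 ^ m], which is polynomial in [n] and [1/eps] for the chosen [m]; this
    admits quantities exponential in the budget. *)
Definition poly_bounded (f : nat -> nat -> nat) : Prop :=
  exists C c, forall n m, n <= 2 ^ m -> f n m <= C * (2 ^ m) ^ c.

Lemma poly_le f g : (forall n m, f n m <= g n m) -> poly_bounded g -> poly_bounded f.
Proof. by move=> h [C [c hC]]; exists C, c => n m nm; apply: leq_trans (h _ _) (hC _ _ nm). Qed.

Lemma poly_cst x : poly_bounded (fun _ _ => x).
Proof. by exists x, 0 => n m _; rewrite muln1. Qed.

Lemma poly_n : poly_bounded (fun n _ => n).
Proof. by exists 1, 1 => n m h; rewrite mul1n expn1. Qed.

Lemma poly_m : poly_bounded (fun _ m => m).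
Proof. by exists 1, 1 => n m h; rewrite mul1n expn1 ltnW // ltn_expl. Qed.

Lemma poly_add f g : poly_bounded f -> poly_bounded g -> poly_bounded (fun n m => f n m + g n m).
Proof.
move=> [C [c hC]] [C' [c' hC']]; exists (C + C'), (c + c') => n m h.
have M0 : 0 < 2 ^ m by rewrite expn_gt0.
rewrite mulnDl; apply: leq_add.
  by apply: leq_trans (hC _ _ h) _; rewrite leq_mul2l leq_pexp2l ?leq_addr ?orbT.
by apply: leq_trans (hC' _ _ h) _; rewrite leq_mul2l leq_pexp2l ?leq_addl ?orbT.
Qed.

Lemma poly_mul f g : poly_bounded f -> poly_bounded g -> poly_bounded (fun n m => f n m * g n m).
Proof.
move=> [C [c hC]] [C' [c' hC']]; exists (C * C'), (c + c') => n m h.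
by rewrite expnD mulnACA leq_mul ?hC ?hC'.
Qed.

Lemma poly_succ f : poly_bounded f -> poly_bounded (fun n m => (f n m).+1).
Proof.
move=> hf; apply: (@poly_le _ (fun n m => f n m + 1)); first by move=> n m; rewrite addn1.
exact: poly_add hf (poly_cst 1).
Qed.

Lemma poly_exp x K : poly_bounded (fun _ m => x ^ (K * m)).
Proof.
exists 1, (x * K) => n m _; rewrite mul1n -expnM; apply: leq_trans (_ : (2 ^ x) ^ (K * m) <= _).
  by case: (K * m) => // y; rewrite leq_exp2r // ltnW // ltn_expl.
by rewrite -expnM mulnA [x * K * m]mulnC.
Qed.

(** The base of the power must not involve [W]: for [f] of order [m], a power of a constant is
    polynomial in [2 ^ m], a power of [W] is not. *)
Lemma ev_time_le k Delta W f : ev_time k Delta W f <=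
  (W * (800 * (k.+1 * (W * W))) + Delta * (2 * (k.+1 * (2000 * (W * W))))) *
  (4 * Delta * k.+1).+1 ^ f.
Proof.
set P := W * _ + _; set G := 4 * Delta * k.+1.
elim: f => [|f IH]; first by rewrite expn0 muln1 leq_addr.
have P0 : P <= P * G.+1 ^ f by rewrite leq_pmulr // expn_gt0.
have -> : ev_time k Delta W f.+1 = P + G * ev_time k Delta W f by rewrite /P /G /=; ring.
rewrite expnS mulnCA mulSn leq_add // leq_mul //.
Qed.

Lemma cnt_time_le C b : cnt_time C b <= C * 3 ^ b.
Proof.
elim: b => [|b IH]; first by rewrite expn0 muln1.
have C0 : C <= C * 3 ^ b by rewrite leq_pmulr // expn_gt0.
by rewrite /= expnS mulnCA; lia.
Qed.

Ltac poly :=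
  match goal with
  | H : poly_bounded ?f |- poly_bounded ?f => exact H
  | |- poly_bounded (fun _ _ => ?x) => exact (poly_cst x)
  | |- poly_bounded (fun n _ => n) => exact poly_n
  | |- poly_bounded (fun _ m => m) => exact poly_m
  | |- poly_bounded (fun n m => (@?f n m).+1) => apply (@poly_succ f); poly
  | |- poly_bounded (fun n m => @?f n m + @?g n m) => apply (@poly_add f g); poly
  | |- poly_bounded (fun n m => @?f n m * @?g n m) => apply (@poly_mul f g); poly
  end.

Lemma main_time_poly k Delta K : poly_bounded (fun n m => main_time n k Delta K m).
Proof.
have hW : poly_bounded (fun n m => (range_bound n Delta K m).+1) by rewrite /range_bound; poly.
have hexp x := poly_exp x K.
have hev : poly_bounded (fun n m => ev_time k Delta (range_bound n Delta K m).+1 (K * m).+1).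
  apply: poly_le; first by move=> n m; exact: ev_time_le.
  have hG : poly_bounded (fun _ m => (4 * Delta * k.+1).+1 ^ (K * m).+1).
    apply: (@poly_le _ (fun _ m => (4 * Delta * k.+1).+1 * (4 * Delta * k.+1).+1 ^ (K * m))).
      by move=> n m; rewrite expnS.
    exact: poly_mul (poly_cst _) (hexp _).
  by poly.
have hcnt : poly_bounded (fun n m => cnt_time (4 * ev_time k Delta (range_bound n Delta K m).+1
    (K * m).+1 + 20 * (range_bound n Delta K m).+1 + 100 * (K * m * n).+2 + 300) (K * m)).
  apply: poly_le; first by move=> n m; exact: cnt_time_le.
  by apply: poly_mul; [poly|exact: hexp].
by rewrite /main_time /solve_time /stage_step_time; poly.
Qed.

End Polynomial.

(** * Numerical conditions and the final assembly *)

Lemma budget_lt x y m : 0 < m -> 1 + x + m * y < (y + x + 2) * m.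
Proof. by move=> m0; rewrite !mulnDl [m * y]mulnC; have := leq_pmulr x m0; lia. Qed.

Local Open Scope ring_scope.

Lemma natr_regroup (C D c : nat) (x : rat) :
  C%:R * (D%:R * (x * x)) ^+ c = (C * D ^ c)%:R * x ^+ (c + c).
Proof. by rewrite natrM natrX !exprMn exprD !mulrA. Qed.

Lemma local_condition (R : realType) (k Delta : nat) : (0 < k)%N ->
  (Delta%:R : R) <= 1 / (Num.sqrt (8%:R * expR 1) * k%:R ^+ 2) * powR 2%:R (k%:R / 2%:R) ->
  (16 * (k ^ 2 * Delta) ^ 2 <= 2 ^ k)%N.
Proof.
move=> k0 h; have kR : 0 < k%:R :> R by rewrite ltr0n.
have e2 : 2 <= expR 1 :> R by have := expR_ge1Dx (1 : R); lra.
set s := Num.sqrt _ in h.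
have s2 : s ^+ 2 = 8 * expR 1 by rewrite sqr_sqrtr // mulr_ge0 // ltW // expR_gt0.
have s0 : 0 < s by rewrite sqrtr_gt0 mulr_gt0 // expR_gt0.
have d0 : 0 < s * k%:R ^+ 2 by rewrite mulr_gt0 // exprn_gt0.
rewrite div1r mulrC ler_pdivlMr // in h.
have p2 : powR 2 (k%:R / 2) ^+ 2 = 2 ^+ k :> R.
  rewrite -(powR_mulrn k (_ : 0 <= 2 :> R)) // -(powR_mulrn 2 (powR_ge0 _ _)) -powRrM.
  by rewrite divfK ?pnatr_eq0.
have h2 : (Delta%:R * (s * k%:R ^+ 2)) ^+ 2 <= 2 ^+ k :> R.
  by rewrite -p2 lerXn2r // nnegrE ?powR_ge0 // mulr_ge0 // ltW.
rewrite -(ler_nat R) natrX; apply: le_trans h2.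
have -> : (Delta%:R * (s * k%:R ^+ 2)) ^+ 2 = s ^+ 2 * (k%:R ^+ 2 * Delta%:R) ^+ 2 :> R by ring.
rewrite s2 natrM natrX natrM natrX; apply: ler_wpM2r; first by rewrite sqr_ge0.
lra.
Qed.

Theorem theorem1p1 (R : realType) (k Delta : nat)
  (hk : (2 <= k)%N) (hDelta : (2 <= Delta)%N)
  (hcond : (Delta%:R : R) <=
           1 / (Num.sqrt (8%:R * expR 1) * k%:R ^+ 2) * powR 2%:R (k%:R / 2%:R)) :
  has_fptas (fun H : hypergraph => k_uniform k H /\ max_degree H = Delta)
            num_vertices hypergraph_encoding num_independent.
Proof.
have k0 : (0 < k)%N by apply: ltnW.
have D0 : (0 < Delta)%N by apply: ltnW.
have hloc := local_condition k0 hcond.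
(* Makes the budget [K * m] exceed the number of positions allowed by [revealed_bound]. *)
set K := ((k ^ 2 * Delta) ^ 2 + k * Delta + 2)%N.
have [C [c hC]] := main_time_poly k Delta K.
(* The factor [128] and the doubled exponent come from [2 ^ m <= 128 * (n + 1/eps) ^ 2]. *)
exists (prog K), (C * 128 ^ c)%N, (c + c)%N => H x [kH dH] [s [us ps xE]] a b ab.
set n := num_vertices H in s us ps xE *.
have hE := edge_lists_regular us ps kH dH; rewrite -/n in hE.
(* Without vertices the maximum degree would be [0]. *)
have n0 : (0 < n)%N.
  rewrite lt0n; apply/eqP => n0; move: hDelta; rewrite -dH /max_degree big1 // => i.
  by have := leq_trans (ltn_ord i) (eq_leq n0); rewrite ltn0.
have [j] := @main_spec n k Delta K a b (edge_lists s) n0 k0 ltac:(by rewrite /K addn2) hE ab.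
set m := (_ + j + 5)%N => -[[t ht tle] hb ha].
case/andP: (ab) => a0 ab'; have b0 : (0 < b)%N := ltn_trans a0 ab'.
have aR : 0 < a%:R :> rat by rewrite ltr0n.
have bR : 0 < b%:R :> rat by rewrite ltr0n.
set eps : rat := a%:R / b%:R; cbv zeta.
have e01 : 0 < eps < 1 by rewrite divr_gt0 //= ltr_pdivrMr // mul1r ltr_nat.
have n_bl : (n <= 2 ^ bit_length n.-1)%N by rewrite -[n in (n <= _)%N](prednK n0) -bit_length_le.
have mE : (2 ^ m = 32 * (2 ^ bit_length n.-1 * 2 ^ j))%N by rewrite /m !expnD mulnC.
have e_lo : 1 <= eps * 2 ^+ j.+1.
  by rewrite /eps mulrAC ler_pdivlMr // mul1r -natrX -natrM ler_nat.
have e_hi : eps * 2 ^+ j <= 2.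
  by rewrite /eps mulrAC ler_pdivrMr // -natrX -!natrM ler_nat.
(* This accounts for the [5] in [m]: [eps * 2 ^ m = 32 * 2 ^ bit_length n.-1 * (eps * 2 ^ j)], where
   the last factor is at least [1/2]. *)
have hm : 16 * n%:R <= eps * 4 ^+ m.
  have le4 : (2 ^ m)%:R <= 4 ^+ m :> rat by rewrite natrX lerXn2r // nnegrE.
  apply: le_trans (_ : eps * (2 ^ m)%:R <= _); last by apply: ler_wpM2l => //; lra.
  rewrite mE 2!natrM !natrX; rewrite exprS in e_lo.
  have nR : n%:R <= 2 ^+ bit_length n.-1 :> rat by rewrite -natrX ler_nat.
  have : 0 <= (2 : rat) ^+ bit_length n.-1 by rewrite exprn_ge0.
  move: nR e_lo; move: (2 ^+ bit_length _) (2 ^+ j) => y z; nra.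
have hB : (1 + k * Delta + m * (k ^ 2 * Delta) ^ 2 < K * m)%N.
  by apply: budget_lt; rewrite /m addnS.
have [st0 acc] := stage_accuracy k0 D0 hloc hB hE e01 n0 hm.
rewrite (nind_edge_lists ps) in acc.
exists (node (enc_nat (2 ^ (K * m * n))) (enc_nat (stage (K * m) (iota 0 n) (edge_lists s) 1))).
exists t, (2 ^ (K * m * n))%N, (stage (K * m) (iota 0 n) (edge_lists s) 1); split=> //.
  rewrite /runs xE; have -> : enc_seq (enc_seq (fun v : 'I_n => enc_nat v)) s =
    enc_seq (enc_seq enc_nat) (edge_lists s) => //.
  by rewrite enc_seq_map; apply: eq_enc_seq => e /=; rewrite enc_seq_map.
have n_m : (n <= 2 ^ m)%N.
  by rewrite mE; apply: leq_trans n_bl _; rewrite mulnCA leq_pmulr // muln_gt0 expn_gt0.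
apply: le_trans (_ : (C * (2 ^ m) ^ c)%:R <= _).
  by rewrite ler_nat; apply: leq_trans tle (hC _ _ n_m).
have bl_n : (2 ^ bit_length n.-1 <= 2 * n)%N.
  case: (posnP n.-1) => [->|n1]; first by rewrite /bit_length up_log1 expn0 muln_gt0.
  by apply: leq_trans (exp_bit_length n1) _; rewrite leq_mul2l leq_pred.
set X : rat := n%:R + eps^-1.
(* [2 ^ bit_length n.-1 <= 2 * n] and [2 ^ j <= 2 / eps], so the constant is [32 * 2 * 2]. *)
have mX : (2 ^ m)%:R <= 128 * (X * X) :> rat.
  have jX : 2 ^+ j <= 2 * eps^-1 :> rat by rewrite ler_pdivlMr ?[2 ^+ j * _]mulrC //; case/andP: e01.
  have blX : 2 ^+ bit_length n.-1 <= 2 * n%:R :> rat by rewrite -natrX -natrM ler_nat.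
  have /andP[e0 _] := e01; have ei : 0 <= eps^-1 by rewrite invr_ge0 ltW.
  have nR : 0 <= n%:R :> rat by rewrite ler0n.
  have hmul := ler_pM (exprn_ge0 _ (ler0n _ 2)) (exprn_ge0 _ (ler0n _ 2)) blX jX.
  have -> : (2 ^ m)%:R = 32 * (2 ^+ bit_length n.-1 * 2 ^+ j) :> rat by rewrite mE 2!natrM !natrX.
  move: hmul; rewrite /X; move: (2 ^+ _ * 2 ^+ _) (eps^-1) (n%:R) ei nR => w y z y0 z0 hw.
  have := mulr_ge0 y0 z0; have := mulr_ge0 y0 y0; have := mulr_ge0 z0 z0; lra.
apply: le_trans (_ : C%:R * (128 * (X * X)) ^+ c <= _).
  rewrite natrM natrX; apply: ler_wpM2l; first exact: ler0n.
  apply: lerXn2r; rewrite ?nnegrE; [exact: ler0n|apply: le_trans mX; exact: ler0n|exact: mX].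
by rewrite natr_regroup.
Qed.
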